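(* The principle of symmetric bar induction $\mathsf{sBI}$ is provable in $\mathsf{E\text{-}PA}^\omega+\mathsf{DC}$. Here $\mathsf{sBI}$ is the schema, for every type $X$ and every formula $P$ on $X^\dagger$: $$\forall\varphi^{X^{\mathbb{N}}\to\mathbb{N}}\Big(\forall\alpha^{X^{\mathbb{N}}}\exists n\,P([\alpha]^{\varphi}_{n})\ \wedge\ \forall u\,\big(S_\varphi(u)\to([\varphi(\hat u)\notin\mathrm{dom}(u)\to\forall x^X P(u\oplus(\varphi(\hat u),x))]\to P(u))\big)\ \to\ P(\emptyset)\Big).$$
   Context: $\mathsf{E\text{-}HA}^\omega$ is extensional Heyting arithmetic in all finite types: full induction, $\lambda$-abstraction, Gödel's primitive recursors at all types, fully extensional equality; its quantifier-free fragment is Gödel's system $\mathsf{T}$. $\mathsf{E\text{-}PA}^\omega$ is its classical version. $\mathsf{DC}$ is the schema of dependent choice at all types $X$: $\forall n^{\mathbb{N}},x^X\exists y^X A_n(x,y)\to\exists f^{\mathbb{N}\to X}\forall n\,A_n(f(n),f(n+1))$ for arbitrary formulas $A$. $X^{\mathbb{N}}$ is the type $\mathbb{N}\to X$. $X^\dagger$ is the type of finite partial functions from $\mathbb{N}$ to $X$ (finite domain $\mathrm{dom}(u)$, decidable membership); $|\mathrm{dom}(u)|$ is its cardinality. $\mathbf{0}_X$ is the canonical element of type $X$. For $u\colon X^\dagger$, $\hat u\colon X^{\mathbb{N}}$ agrees with $u$ on $\mathrm{dom}(u)$ and is $\mathbf{0}_X$ elsewhere; $\hat\varphi(u):=\varphi(\hat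 u)$. $\emptyset$ is the nowhere-defined partial function. $u\oplus(n,x)$ equals $u$ if $n\in\mathrm{dom}(u)$, and otherwise $u$ extended by value $x$ at $n$. The $\varphi$-thread of $\alpha\colon X^{\mathbb{N}}$ of length $i$ is $[\alpha]^{\varphi}_{0}=\emptyset$, $[\alpha]^{\varphi}_{i+1}=[\alpha]^{\varphi}_{i}\oplus(m_i,\alpha(m_i))$ with $m_i:=\hat\varphi([\alpha]^{\varphi}_{i})$. The $\varphi$-thread of $u\colon X^\dagger$ is $[u]^{\varphi}_{0}=\emptyset$, $[u]^{\varphi}_{i+1}=[u]^{\varphi}_{i}\oplus(n_i,u(n_i))$ if $n_i\in\mathrm{dom}(u)$ and $[u]^{\varphi}_{i}$ otherwise, where $n_i:=\hat\varphi([u]^{\varphi}_{i})$. $S_\varphi(u)$ means $u=[u]^{\varphi}_{|\mathrm{dom}(u)|}$. *)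

(* Defs.v *)
(* A deep embedding of extensional Heyting arithmetic in all finite types:
   intrinsically typed de Bruijn syntax and natural deduction.  Provability in
   E-PA^omega + DC is the existence of a derivation in this calculus. *)
From Stdlib Require Import List.
Import ListNotations.
Set Implicit Arguments.

Inductive ty : Type :=
| Nat : ty
| Arr : ty -> ty -> ty
| Prod : ty -> ty -> ty.

Declare Scope ty_scope.
Bind Scope ty_scope with ty.
Delimit Scope ty_scope with ty.
Notation "A ~> B" := (Arr A B) (at level 55, right associativity) : ty_scope.
Notation "A ** B" := (Prod A B) (at level 50, left associativity) : ty_scope.

(* The head of a context is the most recently bound variable. *)
Definition ctx := list ty.

Inductive var : ctx -> ty -> Type :=
| vz : forall G A, var (A :: G) A
| vs : forall G A B, var G A -> var (B :: G) A.
Arguments vz {G A}.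
Arguments vs {G A B} x.

Inductive tm (G : ctx) : ty -> Type :=
| Var : forall A, var G A -> tm G A
| App : forall A B, tm G (A ~> B) -> tm G A -> tm G B
| Lam : forall A B, tm (A :: G) B -> tm G (A ~> B)
| Pair : forall A B, tm G A -> tm G B -> tm G (A ** B)
| Fst : forall A B, tm G (A ** B) -> tm G A
| Snd : forall A B, tm G (A ** B) -> tm G B
| Zero : tm G Nat
| Succ : tm G Nat -> tm G Nat
| Rec : forall A, tm G A -> tm G (Nat ~> A ~> A) -> tm G Nat -> tm G A.
Arguments Var {G A} x.
Arguments App {G A B} s t.
Arguments Lam {G A B} t.
Arguments Pair {G A B} s t.
Arguments Fst {G A B} t.
Arguments Snd {G A B} t.
Arguments Zero {G}.
Arguments Succ {G} t.
Arguments Rec {G A} a f t.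

Inductive fm (G : ctx) : Type :=
| Eq : forall A, tm G A -> tm G A -> fm G
| Bot : fm G
| And : fm G -> fm G -> fm G
| Or : fm G -> fm G -> fm G
| Imp : fm G -> fm G -> fm G
| All : forall A, fm (A :: G) -> fm G
| Ex : forall A, fm (A :: G) -> fm G.
Arguments Eq {G A} s t.
Arguments Bot {G}.
Arguments And {G} F1 F2.
Arguments Or {G} F1 F2.
Arguments Imp {G} F1 F2.
Arguments All {G} A F.
Arguments Ex {G} A F.

Definition Neg {G} (F : fm G) : fm G := Imp F Bot.

Notation v0 := (Var vz).
Notation v1 := (Var (vs vz)).
Notation v2 := (Var (vs (vs vz))).
Notation v3 := (Var (vs (vs (vs vz)))).

Definition ren (G D : ctx) : Type := forall A, var G A -> var D A.
Definition sub (G D : ctx) : Type := forall A, var G A -> tm D A.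

Definition up_ren {G D B} (r : ren G D) : ren (B :: G) (B :: D) :=
  fun A x =>
    match x in var L A' return
          match L with
          | [] => unit
          | B' :: G' => ren G' D -> var (B' :: D) A'
          end
    with
    | vz => fun _ => vz
    | vs y => fun r' => vs (r' _ y)
    end r.

Fixpoint ren_tm {G A} (t : tm G A) : forall {D}, ren G D -> tm D A :=
  match t in tm _ A' return forall D, ren G D -> tm D A' with
  | Var x => fun _ r => Var (r _ x)
  | App s u => fun _ r => App (ren_tm s r) (ren_tm u r)
  | Lam u => fun _ r => Lam (ren_tm u (up_ren r))
  | Pair s u => fun _ r => Pair (ren_tm s r) (ren_tm u r)
  | Fst u => fun _ r => Fst (ren_tm u r)
  | Snd u => fun _ r => Snd (ren_tm u r)
  | Zero => fun _ _ => Zero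
  | Succ u => fun _ r => Succ (ren_tm u r)
  | Rec a f u => fun _ r => Rec (ren_tm a r) (ren_tm f r) (ren_tm u r)
  end.

Definition wk {G A B} (t : tm G A) : tm (B :: G) A := ren_tm t (fun _ => vs).

Definition scons {G D B} (t : tm D B) (s : sub G D) : sub (B :: G) D :=
  fun A x =>
    match x in var L A' return
          match L with
          | [] => unit
          | B' :: G' => tm D B' -> sub G' D -> tm D A'
          end
    with
    | vz => fun t' _ => t'
    | vs y => fun _ s' => s' _ y
    end t s.

Definition up {G D B} (s : sub G D) : sub (B :: G) (B :: D) :=
  scons v0 (fun A x => wk (s A x)).

Fixpoint sub_tm {G A} (t : tm G A) : forall {D}, sub G D -> tm D A :=
  match t in tm _ A' return forall D, sub G D -> tm D A' with
  | Var x => fun _ s => s _ x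
  | App u w => fun _ s => App (sub_tm u s) (sub_tm w s)
  | Lam u => fun _ s => Lam (sub_tm u (up s))
  | Pair u w => fun _ s => Pair (sub_tm u s) (sub_tm w s)
  | Fst u => fun _ s => Fst (sub_tm u s)
  | Snd u => fun _ s => Snd (sub_tm u s)
  | Zero => fun _ _ => Zero
  | Succ u => fun _ s => Succ (sub_tm u s)
  | Rec a f u => fun _ s => Rec (sub_tm a s) (sub_tm f s) (sub_tm u s)
  end.

Fixpoint sub_fm {G} (F : fm G) : forall {D}, sub G D -> fm D :=
  match F with
  | Eq t u => fun _ s => Eq (sub_tm t s) (sub_tm u s)
  | Bot => fun _ _ => Bot
  | And F1 F2 => fun _ s => And (sub_fm F1 s) (sub_fm F2 s)
  | Or F1 F2 => fun _ s => Or (sub_fm F1 s) (sub_fm F2 s)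
  | Imp F1 F2 => fun _ s => Imp (sub_fm F1 s) (sub_fm F2 s)
  | All A F1 => fun _ s => All A (sub_fm F1 (up s))
  | Ex A F1 => fun _ s => Ex A (sub_fm F1 (up s))
  end.

Definition id_sub {G} : sub G G := fun _ x => Var x.
Definition shift1 {G A} : sub G (A :: G) := fun _ x => Var (vs x).
Definition shift2 {G A B} : sub G (A :: B :: G) := fun _ x => Var (vs (vs x)).
Definition shift3 {G A B C} : sub G (A :: B :: C :: G) :=
  fun _ x => Var (vs (vs (vs x))).

Definition wk_fm {G A} (F : fm G) : fm (A :: G) := sub_fm F shift1.

Definition inst_tm {G A B} (t : tm (A :: G) B) (s : tm G A) : tm G B :=
  sub_tm t (scons s id_sub).
Definition inst_fm {G A} (F : fm (A :: G)) (s : tm G A) : fm G :=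
  sub_fm F (scons s id_sub).

Section Derivability.

(* Derivations may contain free variables and hypotheses; [Ax] is the set of
   axioms added to those of E-HA^omega. *)
Variable Ax : forall G, fm G -> Prop.

Inductive prf : forall G, list (fm G) -> fm G -> Prop :=
| p_ax : forall G (H : list (fm G)) F, Ax F -> prf H F
| p_hyp : forall G (H : list (fm G)) F, In F H -> prf H F
| p_botE : forall G (H : list (fm G)) F, prf H Bot -> prf H F
| p_andI : forall G (H : list (fm G)) F1 F2,
    prf H F1 -> prf H F2 -> prf H (And F1 F2)
| p_andE1 : forall G (H : list (fm G)) F1 F2, prf H (And F1 F2) -> prf H F1
| p_andE2 : forall G (H : list (fm G)) F1 F2, prf H (And F1 F2) -> prf H F2
| p_orI1 : forall G (H : list (fm G)) F1 F2, prf H F1 -> prf H (Or F1 F2)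
| p_orI2 : forall G (H : list (fm G)) F1 F2, prf H F2 -> prf H (Or F1 F2)
| p_orE : forall G (H : list (fm G)) F1 F2 F,
    prf H (Or F1 F2) -> prf (F1 :: H) F -> prf (F2 :: H) F -> prf H F
| p_impI : forall G (H : list (fm G)) F1 F2,
    prf (F1 :: H) F2 -> prf H (Imp F1 F2)
| p_impE : forall G (H : list (fm G)) F1 F2,
    prf H (Imp F1 F2) -> prf H F1 -> prf H F2
| p_allI : forall G (H : list (fm G)) A (F : fm (A :: G)),
    prf (map wk_fm H) F -> prf H (All A F)
| p_allE : forall G (H : list (fm G)) A (F : fm (A :: G)) t,
    prf H (All A F) -> prf H (inst_fm F t)
| p_exI : forall G (H : list (fm G)) A (F : fm (A :: G)) t,
    prf H (inst_fm F t) -> prf H (Ex A F)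
| p_exE : forall G (H : list (fm G)) A (F : fm (A :: G)) F',
    prf H (Ex A F) -> prf (F :: map wk_fm H) (wk_fm F') -> prf H F'
| p_refl : forall G (H : list (fm G)) A (t : tm G A), prf H (Eq t t)
| p_leibniz : forall G (H : list (fm G)) A (F : fm (A :: G)) s t,
    prf H (Eq s t) -> prf H (inst_fm F s) -> prf H (inst_fm F t)
| p_ext : forall G (H : list (fm G)) A B (f g : tm G (A ~> B)),
    prf H (All A (Eq (App (wk f) v0) (App (wk g) v0))) -> prf H (Eq f g)
| p_beta : forall G (H : list (fm G)) A B (t : tm (A :: G) B) s,
    prf H (Eq (App (Lam t) s) (inst_tm t s))
| p_fst : forall G (H : list (fm G)) A B (s : tm G A) (t : tm G B),
    prf H (Eq (Fst (Pair s t)) s)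
| p_snd : forall G (H : list (fm G)) A B (s : tm G A) (t : tm G B),
    prf H (Eq (Snd (Pair s t)) t)
| p_pair : forall G (H : list (fm G)) A B (t : tm G (A ** B)),
    prf H (Eq (Pair (Fst t) (Snd t)) t)
| p_rec0 : forall G (H : list (fm G)) A (a : tm G A) f,
    prf H (Eq (Rec a f Zero) a)
| p_recS : forall G (H : list (fm G)) A (a : tm G A) f n,
    prf H (Eq (Rec a f (Succ n)) (App (App f n) (Rec a f n)))
| p_succ0 : forall G (H : list (fm G)) n, prf H (Neg (Eq (Succ n) Zero))
| p_succI : forall G (H : list (fm G)) m n,
    prf H (Eq (Succ m) (Succ n)) -> prf H (Eq m n)
| p_ind : forall G (H : list (fm G)) (F : fm (Nat :: G)),
    prf H (inst_fm F Zero) ->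
    prf H (All Nat (Imp F (sub_fm F (scons (Succ v0) shift1)))) ->
    prf H (All Nat F).

End Derivability.

Inductive LEM : forall G, fm G -> Prop :=
| lem_intro : forall G (F : fm G), LEM (Or F (Neg F)).

(* In [F] the last three variables are n, x, y, with y the most recent; the
   substitution replaces them by n, f(n), f(n+1). *)
Definition dc_fm {G} (X : ty) (F : fm (X :: X :: Nat :: G)) : fm G :=
  Imp (All Nat (All X (Ex X F)))
      (Ex (Nat ~> X) (All Nat
         (sub_fm F (scons (App v1 (Succ v0))
                   (scons (App v1 v0)
                   (scons v0 shift2)))))).

Inductive DC : forall G, fm G -> Prop :=
| dc_intro : forall G X (F : fm (X :: X :: Nat :: G)), DC (dc_fm F).

Definition EHAw {G} (H : list (fm G)) (F : fm G) : Prop :=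
  prf (fun _ _ => False) H F.
Definition EPAw {G} (H : list (fm G)) (F : fm G) : Prop := prf LEM H F.
Definition EPAw_DC {G} (H : list (fm G)) (F : fm G) : Prop :=
  prf (fun _ F' => LEM F' \/ DC F') H F.

Fixpoint canon {G} (X : ty) : tm G X :=
  match X with
  | Nat => Zero
  | Arr A B => Lam (canon B)
  | Prod A B => Pair (canon A) (canon B)
  end.

(* [ifz n s t] is [s] if [n = 0] and [t] otherwise. *)
Definition ifz {G A} (n : tm G Nat) (s t : tm G A) : tm G A :=
  Rec s (Lam (Lam (wk (wk t)))) n.

Definition one {G} : tm G Nat := Succ Zero.
Definition add {G} (m n : tm G Nat) : tm G Nat := Rec m (Lam (Lam (Succ v0))) n.
Definition pred {G} (n : tm G Nat) : tm G Nat := Rec Zero (Lam (Lam v1)) n.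
Definition monus {G} (m n : tm G Nat) : tm G Nat := Rec m (Lam (Lam (pred v0))) n.
Definition max {G} (m n : tm G Nat) : tm G Nat := add m (monus n m).
(* zero iff [m = n] *)
Definition dist {G} (m n : tm G Nat) : tm G Nat := add (monus m n) (monus n m).
Definition leq {G} (m n : tm G Nat) : fm G := Eq (monus m n) Zero.

(* A finite partial function is coded by a triple (b, (c, v)): [c] is the
   characteristic function of the domain, [v] the values, extended by the
   canonical element outside the domain, and [b] is 0 if the domain is empty
   and otherwise 1 + its largest element.  [is_pf] singles out the codes;
   every finite partial function has exactly one, so the equality of [S_phi]
   is equality of codes, and quantifiers over X^dagger are those over
   [pfun X] relativised to [is_pf]. *)
Definition pfun (X : ty) : ty := Nat ** ((Nat ~> Nat) ** (Nat ~> X)).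

Definition bnd {G X} (u : tm G (pfun X)) : tm G Nat := Fst u.
Definition chi {G X} (u : tm G (pfun X)) (n : tm G Nat) : tm G Nat :=
  App (Fst (Snd u)) n.
Definition val {G X} (u : tm G (pfun X)) (n : tm G Nat) : tm G X :=
  App (Snd (Snd u)) n.

Definition in_dom {G X} (n : tm G Nat) (u : tm G (pfun X)) : fm G :=
  Eq (chi u n) one.

Definition is_pf {G X} (u : tm G (pfun X)) : fm G :=
  And (All Nat (Or (Eq (chi (wk u) v0) Zero) (Eq (chi (wk u) v0) one)))
 (And (All Nat (Imp (Eq (chi (wk u) v0) Zero) (Eq (val (wk u) v0) (canon X))))
 (And (All Nat (Imp (leq (bnd (wk u)) v0) (Eq (chi (wk u) v0) Zero)))
      (All Nat (Imp (Eq (bnd (wk u)) (Succ v0)) (in_dom v0 (wk u)))))).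

Definition All_pf {G} (X : ty) (F : fm (pfun X :: G)) : fm G :=
  All (pfun X) (Imp (is_pf v0) F).

Definition empty {G} (X : ty) : tm G (pfun X) :=
  Pair Zero (Pair (Lam Zero) (Lam (canon X))).

Definition card {G X} (u : tm G (pfun X)) : tm G Nat :=
  Rec Zero (Lam (Lam (add v0 (chi (wk (wk u)) v1)))) (bnd u).

Definition hat {G X} (u : tm G (pfun X)) : tm G (Nat ~> X) :=
  Lam (ifz (chi (wk u) v0) (canon X) (val (wk u) v0)).

Definition oplus {G X} (u : tm G (pfun X)) (n : tm G Nat) (x : tm G X) :
    tm G (pfun X) :=
  ifz (chi u n)
    (Pair (max (bnd u) (Succ n))
       (Pair (Lam (ifz (dist v0 (wk n)) one (chi (wk u) v0)))
             (Lam (ifz (dist v0 (wk n)) (wk x) (val (wk u) v0)))))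
    u.

Definition hat_app {G X} (phi : tm G ((Nat ~> X) ~> Nat)) (u : tm G (pfun X)) :
    tm G Nat :=
  App phi (hat u).

Definition thread {G X} (phi : tm G ((Nat ~> X) ~> Nat)) (alpha : tm G (Nat ~> X))
    (i : tm G Nat) : tm G (pfun X) :=
  Rec (empty X)
    (Lam (Lam
       (let m := hat_app (wk (wk phi)) v0 in
        oplus v0 m (App (wk (wk alpha)) m))))
    i.

Definition thread_pf {G X} (phi : tm G ((Nat ~> X) ~> Nat)) (u : tm G (pfun X))
    (i : tm G Nat) : tm G (pfun X) :=
  Rec (empty X)
    (Lam (Lam
       (let n := hat_app (wk (wk phi)) v0 in
        ifz (chi (wk (wk u)) n) v0 (oplus v0 n (val (wk (wk u)) n)))))
    i.

Definition S_phi {G X} (phi : tm G ((Nat ~> X) ~> Nat)) (u : tm G (pfun X)) :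
    fm G :=
  Eq u (thread_pf phi u (card u)).

(* [P] may have parameters, the variables of [G]; its most recent variable is
   the one of type X^dagger.  The substitution [scons w shift_k] puts [w] for
   it and skips the k variables bound so far.  Bound variables, outermost
   first: phi; then alpha, n in the first premise, and u, x in the second. *)
Definition sBI {G} (X : ty) (P : fm (pfun X :: G)) : fm G :=
  All ((Nat ~> X) ~> Nat)
    (Imp
      (And
        (All (Nat ~> X) (Ex Nat (sub_fm P (scons (thread v2 v1 v0) shift3))))
        (All_pf
          (Imp (S_phi v1 v0)
            (Imp
              (Imp (Neg (in_dom (App v1 (hat v0)) v0))
                   (All X (sub_fm P (scons (oplus v1 (App v2 (hat v1)) v0) shift3))))
              (sub_fm P (scons v0 shift2))))))
      (sub_fm P (scons (empty X) shift1))).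

(* Main.v *)
Require Import Defs.
From Stdlib Require Import List Arith Lia Cantor.
From Stdlib Require Import FunctionalExtensionality PropExtensionality.
From Stdlib Require Import ProofIrrelevance Classical ClassicalEpsilon Eqdep.
Import ListNotations.

(* By a Henkin completeness theorem it suffices to verify sBI in every model.
   Suppose there that P fails at the empty function.  A stage is a number i with
   a total function a whose thread [a]_i has exactly i elements and is not in P;
   then S_phi([a]_i) holds, so the second premise yields a point outside the
   domain and a new value for a at that point leading to a stage i+1.  Threads
   depend only on the values they have read, so the functions obtained by
   dependent choice agree wherever it matters.  Their limit, which exists by
   countable choice, has all its threads outside P, against the first premise. *)

Set Implicit Arguments.

(** * Substitution *)

Lemma var_case (B : ty) (G : ctx) (Q : forall A, var (B :: G) A -> Prop) :
  Q B vz -> (forall A (x : var G A), Q A (vs x)) -> forall A x, Q A x.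
Proof.
  intros Hz Hs A x.
  refine (match x as x' in var L A' return
            match L return var L A' -> Prop with
            | [] => fun _ => True
            | B' :: G' => fun y => forall Q' : forall A, var (B' :: G') A -> Prop,
                Q' B' vz -> (forall A (z : var G' A), Q' A (vs z)) -> Q' A' y
            end x' with vz => _ | vs y => _ end Q Hz Hs); auto.
Qed.

Lemma var_nil (A : ty) (x : var [] A) : False.
Proof. inversion x. Qed.

Lemma sub_eq_cons (D : ty -> Type) (B : ty) (G : ctx)
    (s s' : forall A, var (B :: G) A -> D A) :
  s B vz = s' B vz -> (forall A x, s A (vs x) = s' A (vs x)) -> s = s'.
Proof.
  intros Hz Hs. extensionality A. extensionality x.
  revert A x. apply var_case; auto.
Qed.

Lemma sub_eq_nil (D : ty -> Type) (s s' : forall A, var [] A -> D A) : s = s'.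
Proof. extensionality A. extensionality x. destruct (var_nil x). Qed.

Definition comp {G D E} (s : sub G D) (s' : sub D E) : sub G E :=
  fun A x => sub_tm (s A x) s'.

Definition snil {D} : sub [] D := fun A x => match var_nil x with end.

Lemma ren_ren G A (t : tm G A) D E (r : ren G D) (r' : ren D E) :
  ren_tm (ren_tm t r) r' = ren_tm t (fun A x => r' A (r A x)).
Proof.
  revert D E r r'. induction t; intros; cbn; f_equal; auto.
  rewrite IHt. f_equal. apply sub_eq_cons; reflexivity.
Qed.

Lemma sub_ren G A (t : tm G A) D E (r : ren G D) (s : sub D E) :
  sub_tm (ren_tm t r) s = sub_tm t (fun A x => s A (r A x)).
Proof.
  revert D E r s. induction t; intros; cbn; f_equal; auto.
  rewrite IHt. f_equal. apply sub_eq_cons; reflexivity.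
Qed.

Lemma ren_sub G A (t : tm G A) D E (s : sub G D) (r : ren D E) :
  ren_tm (sub_tm t s) r = sub_tm t (fun A x => ren_tm (s A x) r).
Proof.
  revert D E s r. induction t; intros; cbn; f_equal; auto.
  rewrite IHt. f_equal. apply sub_eq_cons; [reflexivity|].
  intros. cbn. unfold wk. now rewrite !ren_ren.
Qed.

Lemma up_comp G D E B (s : sub G D) (s' : sub D E) :
  comp (up (B := B) s) (up s') = up (comp s s').
Proof.
  apply sub_eq_cons; [reflexivity|].
  intros. cbn. unfold comp, wk. now rewrite sub_ren, ren_sub.
Qed.

Lemma sub_sub G A (t : tm G A) D E (s : sub G D) (s' : sub D E) :
  sub_tm (sub_tm t s) s' = sub_tm t (comp s s').
Proof.
  revert D E s s'. induction t; intros; cbn; f_equal; auto.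
  rewrite IHt. f_equal. apply up_comp.
Qed.

Lemma up_id G B : up (B := B) (@id_sub G) = id_sub.
Proof. apply sub_eq_cons; reflexivity. Qed.

Lemma sub_id G A (t : tm G A) : sub_tm t id_sub = t.
Proof.
  induction t; cbn; f_equal; auto. now rewrite up_id.
Qed.

Lemma wk_sub G A B (t : tm G A) : wk (B := B) t = sub_tm t shift1.
Proof.
  transitivity (ren_tm (sub_tm t id_sub) (fun _ => @vs _ _ B)).
  - now rewrite sub_id.
  - rewrite ren_sub. reflexivity.
Qed.

Lemma sub_sub_fm G (F : fm G) D E (s : sub G D) (s' : sub D E) :
  sub_fm (sub_fm F s) s' = sub_fm F (comp s s').
Proof.
  revert D E s s'. induction F; intros; cbn; f_equal; auto using sub_sub.
  - rewrite IHF. f_equal. apply up_comp.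
  - rewrite IHF. f_equal. apply up_comp.
Qed.

Lemma sub_id_fm G (F : fm G) : sub_fm F id_sub = F.
Proof.
  induction F; cbn; f_equal; auto using sub_id; now rewrite up_id.
Qed.

Lemma comp_scons G D E B (t : tm D B) (s : sub G D) (s' : sub D E) :
  comp (scons t s) s' = scons (sub_tm t s') (comp s s').
Proof. apply sub_eq_cons; reflexivity. Qed.

Lemma comp_id_r G D (s : sub G D) : comp s id_sub = s.
Proof. extensionality A. extensionality x. apply sub_id. Qed.

Lemma comp_up_scons G D E B (s : sub G D) (t : tm E B) (s' : sub D E) :
  comp (up s) (scons t s') = scons t (comp s s').
Proof.
  apply sub_eq_cons; [reflexivity|].
  intros. cbn. unfold comp. cbn. now rewrite wk_sub, sub_sub.
Qed.

Lemma comp_shift_up G D B (s : sub G D) :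
  comp shift1 (up (B := B) s) = comp s shift1.
Proof. extensionality A. extensionality x. apply wk_sub. Qed.

Lemma sub_inst_fm G D A (F : fm (A :: G)) t (s : sub G D) :
  sub_fm (inst_fm F t) s = inst_fm (sub_fm F (up s)) (sub_tm t s).
Proof.
  unfold inst_fm. now rewrite !sub_sub_fm, comp_scons, comp_up_scons, comp_id_r.
Qed.

Lemma sub_inst_tm G D A B (u : tm (A :: G) B) t (s : sub G D) :
  sub_tm (inst_tm u t) s = inst_tm (sub_tm u (up s)) (sub_tm t s).
Proof.
  unfold inst_tm. now rewrite !sub_sub, comp_scons, comp_up_scons, comp_id_r.
Qed.

Lemma sub_wk G D A B (t : tm G A) (s : sub G D) :
  sub_tm (wk (B := B) t) (up s) = wk (sub_tm t s).
Proof. now rewrite !wk_sub, !sub_sub, comp_shift_up. Qed.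

Lemma sub_wk_fm G D B (F : fm G) (s : sub G D) :
  sub_fm (wk_fm (A := B) F) (up s) = wk_fm (sub_fm F s).
Proof. unfold wk_fm. now rewrite !sub_sub_fm, comp_shift_up. Qed.

Lemma inst_wk_fm G A (F : fm G) (t : tm G A) : inst_fm (wk_fm F) t = F.
Proof. unfold inst_fm, wk_fm. rewrite sub_sub_fm. apply sub_id_fm. Qed.

Lemma inst_wk_tm G A B (u : tm G B) (t : tm G A) : inst_tm (wk u) t = u.
Proof. unfold inst_tm. rewrite wk_sub, sub_sub. apply sub_id. Qed.

Lemma inst_up_fm G D A (F : fm (A :: G)) (s : sub G D) t :
  inst_fm (sub_fm F (up s)) t = sub_fm F (scons t s).
Proof. unfold inst_fm. now rewrite sub_sub_fm, comp_up_scons, comp_id_r. Qed.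

Lemma inst_up_tm G D A B (u : tm (A :: G) B) (s : sub G D) t :
  inst_tm (sub_tm u (up s)) t = sub_tm u (scons t s).
Proof. unfold inst_tm. now rewrite sub_sub, comp_up_scons, comp_id_r. Qed.

(** * Derivations *)

Section Derivations.

Variable Ax : forall G, fm G -> Prop.
Hypothesis Ax_sub : forall G D (F : fm G) (s : sub G D), Ax F -> Ax (sub_fm F s).

Lemma prf_weaken G (H : list (fm G)) F :
  prf Ax H F -> forall H', incl H H' -> prf Ax H' F.
Proof.
  assert (K : forall G (F : fm G) H H', incl H H' -> incl (F :: H) (F :: H')).
  { intros. apply incl_cons; [apply in_eq|]. now apply incl_tl. }
  induction 1; intros H' HI.
  - now apply p_ax.
  - apply p_hyp. auto.
  - apply p_botE. auto.
  - apply p_andI; auto.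
  - eapply p_andE1; auto.
  - eapply p_andE2; auto.
  - apply p_orI1; auto.
  - apply p_orI2; auto.
  - eapply p_orE; auto.
  - apply p_impI; auto.
  - eapply p_impE; auto.
  - apply p_allI. auto using incl_map.
  - apply p_allE. auto.
  - eapply p_exI; auto.
  - eapply p_exE; auto using incl_map.
  - apply p_refl.
  - eapply p_leibniz; auto.
  - apply p_ext. auto.
  - apply p_beta.
  - apply p_fst.
  - apply p_snd.
  - apply p_pair.
  - apply p_rec0.
  - apply p_recS.
  - apply p_succ0.
  - apply p_succI. auto.
  - apply p_ind; auto.
Qed.

Lemma map_wk_sub G D B (H : list (fm G)) (s : sub G D) :
  map (fun F => sub_fm F (up s)) (map (wk_fm (A := B)) H) =
  map wk_fm (map (fun F => sub_fm F s) H).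
Proof. rewrite !map_map. apply map_ext. intros. apply sub_wk_fm. Qed.

Lemma prf_sub G (H : list (fm G)) F :
  prf Ax H F -> forall D (s : sub G D),
  prf Ax (map (fun F => sub_fm F s) H) (sub_fm F s).
Proof.
  induction 1; intros D sg; cbn in *.
  - now apply p_ax, Ax_sub.
  - apply p_hyp. now apply in_map with (f := fun F => sub_fm F sg).
  - now apply p_botE.
  - now apply p_andI.
  - eapply p_andE1. auto.
  - eapply p_andE2. auto.
  - now apply p_orI1.
  - now apply p_orI2.
  - eapply p_orE; auto.
  - now apply p_impI.
  - eapply p_impE; auto.
  - apply p_allI. rewrite <- map_wk_sub. apply IHprf.
  - rewrite sub_inst_fm. apply p_allE. apply IHprf.
  - apply p_exI with (sub_tm t sg). rewrite <- sub_inst_fm. apply IHprf.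
  - eapply p_exE; [apply IHprf1|].
    rewrite <- map_wk_sub, <- sub_wk_fm. apply IHprf2.
  - apply p_refl.
  - rewrite sub_inst_fm. eapply p_leibniz; [apply IHprf1|].
    rewrite <- sub_inst_fm. apply IHprf2.
  - apply p_ext. specialize (IHprf D sg). rewrite !sub_wk in IHprf. apply IHprf.
  - rewrite sub_inst_tm. apply p_beta.
  - apply p_fst.
  - apply p_snd.
  - apply p_pair.
  - apply p_rec0.
  - apply p_recS.
  - apply p_succ0.
  - now apply p_succI.
  - apply p_ind.
    + specialize (IHprf1 D sg). now rewrite sub_inst_fm in IHprf1.
    + specialize (IHprf2 D sg). rewrite sub_sub_fm in IHprf2 |- *.
      replace (comp (up sg) (scons (Succ v0) shift1))
        with (comp (scons (Succ v0) shift1) (up sg)); [exact IHprf2|].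
      now rewrite comp_scons, comp_up_scons, comp_shift_up.
Qed.

Lemma prf_closed G (H : list (fm G)) F : prf Ax [] F -> prf Ax H F.
Proof. intros. eapply prf_weaken; eauto. intros ? []. Qed.

Lemma prf_rewrite_tm G (H : list (fm G)) A B (u : tm (A :: G) B) s t :
  prf Ax H (Eq s t) -> prf Ax H (Eq (inst_tm u s) (inst_tm u t)).
Proof.
  intros E.
  pose proof (p_leibniz (Eq (wk (inst_tm u s)) u) (t := t) E) as L.
  change (inst_fm (Eq (wk (inst_tm u s)) u) ?x) with
    (Eq (inst_tm (wk (inst_tm u s)) x) (inst_tm u x)) in L.
  rewrite !inst_wk_tm in L. apply L, p_refl.
Qed.

Lemma prf_sym G (H : list (fm G)) A (s t : tm G A) :
  prf Ax H (Eq s t) -> prf Ax H (Eq t s).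
Proof.
  intros E.
  pose proof (p_leibniz (Eq v0 (wk s)) (t := t) E) as L.
  change (inst_fm (Eq v0 (wk s)) ?x) with (Eq x (inst_tm (wk s) x)) in L.
  rewrite !inst_wk_tm in L. apply L, p_refl.
Qed.

Lemma prf_trans G (H : list (fm G)) A (s t u : tm G A) :
  prf Ax H (Eq s t) -> prf Ax H (Eq t u) -> prf Ax H (Eq s u).
Proof.
  intros E E'.
  pose proof (p_leibniz (Eq (wk s) v0) (t := u) E') as L.
  change (inst_fm (Eq (wk s) v0) ?x) with (Eq (inst_tm (wk s) x) x) in L.
  rewrite !inst_wk_tm in L. now apply L.
Qed.

Lemma prf_app_cong G (H : list (fm G)) A B (f g : tm G (A ~> B)) s t :
  prf Ax H (Eq f g) -> prf Ax H (Eq s t) -> prf Ax H (Eq (App f s) (App g t)).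
Proof.
  intros E E'. apply prf_trans with (App g s).
  - pose proof (prf_rewrite_tm (App v0 (wk s)) E) as L.
    change (inst_tm (App v0 (wk s)) ?x) with (App x (inst_tm (wk s) x)) in L.
    now rewrite !inst_wk_tm in L.
  - pose proof (prf_rewrite_tm (App (wk g) v0) E') as L.
    change (inst_tm (App (wk g) v0) ?x) with (App (inst_tm (wk g) x) x) in L.
    now rewrite !inst_wk_tm in L.
Qed.

(* Abstracting the variables of the finite context one at a time reduces the
   congruence to that of application. *)
Lemma prf_sub_cong G D (H : list (fm D)) (s s' : sub G D) :
  (forall A x, prf Ax H (Eq (s A x) (s' A x))) ->
  forall A (t : tm G A), prf Ax H (Eq (sub_tm t s) (sub_tm t s')).
Proof.
  induction G as [|B G IH]; intros E A t.
  - rewrite (sub_eq_nil (tm D) s s'). apply p_refl.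
  - assert (L : forall s0 : sub (B :: G) D, prf Ax H
      (Eq (App (sub_tm (Lam t) (fun A x => s0 A (vs x))) (s0 B vz)) (sub_tm t s0))).
    { intros s0. cbn.
      replace (sub_tm t s0) with
        (inst_tm (sub_tm t (up (fun A x => s0 A (vs x)))) (s0 B vz)); [apply p_beta|].
      rewrite inst_up_tm. f_equal. now apply sub_eq_cons. }
    eapply prf_trans; [apply prf_sym, L|]. eapply prf_trans; [|apply L].
    apply prf_app_cong; auto.
Qed.

End Derivations.

(** * Countability of the syntax *)

Definition code_pair (m n : nat) : nat := Cantor.to_nat (m, n).

Arguments code_pair : simpl never.

Lemma code_pair_inj m n m' n' : code_pair m n = code_pair m' n' -> m = m' /\ n = n'.
Proof. intros E. apply (Cantor.to_nat_inj (m, n) (m', n')) in E. now inversion E. Qed.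

Fixpoint code_ty (A : ty) : nat :=
  match A with
  | Nat => code_pair 0 0
  | Arr A B => code_pair 1 (code_pair (code_ty A) (code_ty B))
  | Prod A B => code_pair 2 (code_pair (code_ty A) (code_ty B))
  end.

Fixpoint code_var {G A} (x : var G A) : nat :=
  match x with vz => 0 | vs y => S (code_var y) end.

Fixpoint code_tm {G A} (t : tm G A) : nat :=
  match t with
  | Var x => code_pair 0 (code_var x)
  | App s u => code_pair 1 (code_pair (code_tm s) (code_tm u))
  | @Lam _ A _ u => code_pair 2 (code_pair (code_ty A) (code_tm u))
  | Pair s u => code_pair 3 (code_pair (code_tm s) (code_tm u))
  | Fst u => code_pair 4 (code_tm u)
  | Snd u => code_pair 5 (code_tm u)
  | Zero => code_pair 6 0
  | Succ u => code_pair 7 (code_tm u)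
  | Rec a f u => code_pair 8 (code_pair (code_tm a) (code_pair (code_tm f) (code_tm u)))
  end.

Fixpoint code_fm {G} (F : fm G) : nat :=
  match F with
  | Eq s u => code_pair 0 (code_pair (code_tm s) (code_tm u))
  | Bot => code_pair 1 0
  | And F1 F2 => code_pair 2 (code_pair (code_fm F1) (code_fm F2))
  | Or F1 F2 => code_pair 3 (code_pair (code_fm F1) (code_fm F2))
  | Imp F1 F2 => code_pair 4 (code_pair (code_fm F1) (code_fm F2))
  | All A F1 => code_pair 5 (code_pair (code_ty A) (code_fm F1))
  | Ex A F1 => code_pair 6 (code_pair (code_ty A) (code_fm F1))
  end.

Ltac code_inv :=
  repeat match goal with
  | E : code_pair _ _ = code_pair _ _ |- _ =>
      apply code_pair_inj in E; destruct E; try discriminate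
  end.

Ltac dep_inv :=
  repeat match goal with
  | E : existT _ ?A _ = existT _ ?A _ |- _ => apply inj_pair2 in E; subst
  | E : existT _ ?A _ = existT _ ?B _ |- _ =>
      let E' := fresh in
      pose proof (EqdepFacts.eq_sigT_fst E) as E'; inversion E'; subst; try clear E'
  end; try reflexivity.

Lemma code_ty_inj A B : code_ty A = code_ty B -> A = B.
Proof.
  revert B. induction A; destruct B; cbn; intros E; code_inv; f_equal; auto.
Qed.

Lemma code_var_inj G A (x : var G A) B (y : var G B) :
  code_var x = code_var y -> existT _ A x = existT _ B y.
Proof.
  revert B y. induction x as [G A|G A C x IH].
  - refine (var_case (fun B y => code_var vz = code_var y -> existT _ _ vz = existT _ B y) _ _);
      [reflexivity|discriminate].
  - refine (var_case (fun B y => code_var (vs x) = code_var y ->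
        existT _ _ (vs x) = existT _ B y) _ _); [discriminate|].
    intros B y E. injection E as E. apply IH in E. now dep_inv.
Qed.

Lemma code_tm_inj G A (t : tm G A) B (u : tm G B) :
  code_tm t = code_tm u -> existT _ A t = existT _ B u.
Proof.
  revert B u. induction t; intros C w; destruct w; cbn; intros E; code_inv;
  repeat match goal with
  | IH : forall B u, code_tm ?t = code_tm u -> _, E : code_tm ?t = code_tm _ |- _ =>
      apply IH in E
  | E : code_ty _ = code_ty _ |- _ => apply code_ty_inj in E; subst
  end.
  all: try apply code_var_inj in H0; dep_inv.
Qed.

Lemma code_fm_inj G (F F' : fm G) : code_fm F = code_fm F' -> F = F'.
Proof.
  revert F'. induction F; intros F'; destruct F'; cbn; intros E; code_inv;
  repeat match goal with
  | E : code_tm _ = code_tm _ |- _ => apply code_tm_inj in E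
  | E : code_ty _ = code_ty _ |- _ => apply code_ty_inj in E; subst
  end; try (f_equal; now auto).
  dep_inv.
Qed.

(** * Henkin completeness *)

Definition env (D : ty -> Type) (G : ctx) : Type := forall A, var G A -> D A.

Definition enil {D} : env D [] := fun A x => match var_nil x with end.

Definition econs {D G B} (d : D B) (r : env D G) : env D (B :: G) :=
  fun A x =>
    match x in var L A' return
          match L with
          | [] => unit
          | B' :: G' => D B' -> env D G' -> D A'
          end
    with
    | vz => fun d' _ => d'
    | vs y => fun _ r' => r' _ y
    end d r.

Record structure : Type := {
  dom :> ty -> Type;
  mapp : forall {A B}, dom (A ~> B) -> dom A -> dom B;
  mlam : forall {G A B}, tm (A :: G) B -> env dom G -> dom (A ~> B);
  mpair : forall {A B}, dom A -> dom B -> dom (A ** B);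
  mfst : forall {A B}, dom (A ** B) -> dom A;
  msnd : forall {A B}, dom (A ** B) -> dom B;
  mzero : dom Nat;
  msucc : dom Nat -> dom Nat;
  mrec : forall {A}, dom A -> dom (Nat ~> A ~> A) -> dom Nat -> dom A
}.

Section Semantics.

Variable M : structure.

Fixpoint ev {G A} (t : tm G A) : env M G -> M A :=
  match t in tm _ A' return env M G -> M A' with
  | Var x => fun r => r _ x
  | App s u => fun r => mapp M (ev s r) (ev u r)
  | Lam u => fun r => mlam M u r
  | Pair s u => fun r => mpair M (ev s r) (ev u r)
  | Fst u => fun r => mfst M (ev u r)
  | Snd u => fun r => msnd M (ev u r)
  | Zero => fun _ => mzero M
  | Succ u => fun r => msucc M (ev u r)
  | Rec a f u => fun r => mrec M (ev a r) (ev f r) (ev u r)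
  end.

Fixpoint sat {G} (F : fm G) : env M G -> Prop :=
  match F with
  | Eq s t => fun r => ev s r = ev t r
  | Bot => fun _ => False
  | And F1 F2 => fun r => sat F1 r /\ sat F2 r
  | Or F1 F2 => fun r => sat F1 r \/ sat F2 r
  | Imp F1 F2 => fun r => sat F1 r -> sat F2 r
  | All A F1 => fun r => forall d, sat F1 (econs d r)
  | Ex A F1 => fun r => exists d, sat F1 (econs d r)
  end.

End Semantics.

Record is_model (Ax : forall G, fm G -> Prop) (M : structure) : Prop := {
  model_beta : forall G A B (t : tm (A :: G) B) (r : env M G) d,
    mapp M (mlam M t r) d = ev M t (econs d r);
  model_sound : forall G (F : fm G) r, prf Ax [] F -> sat M F r
}.

Section Henkin.

Variable Ax : forall G, fm G -> Prop.
Hypothesis Ax_sub : forall G D (F : fm G) (s : sub G D), Ax F -> Ax (sub_fm F s).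
Hypothesis Ax_lem : forall G (F : fm G), Ax (Or F (Neg F)).

Variable G0 : ctx.
Variable H0 : list (fm G0).
Hypothesis H0_consistent : ~ prf Ax H0 Bot.

(* The number [k] codes a type [A], a stage [m] and a formula with a free
   variable of type [A] over [gctx m]; stage [S k] adds a variable of type [A],
   assumed to satisfy that formula if the existence of a witness is consistent.
   As the added type depends on [k] only, the contexts are fixed in advance. *)
Definition wty (k : nat) : ty :=
  epsilon (inhabits Nat) (fun A => code_ty A = fst (Cantor.of_nat k)).

Fixpoint gctx (k : nat) : ctx :=
  match k with 0 => G0 | S k' => wty k' :: gctx k' end.

(* Junk value [canon] if [k < m]. *)
Fixpoint lift (m k : nat) {struct k} : sub (gctx m) (gctx k) :=
  match Nat.eq_dec m k with
  | left e => match e in _ = k return sub (gctx m) (gctx k) with eq_refl => id_sub end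
  | right _ =>
      match k return sub (gctx m) (gctx k) with
      | 0 => fun A _ => canon A
      | S k' => fun A x => wk (lift m k' x)
      end
  end.

Definition candidate (m c k : nat) : fm (wty k :: gctx k) :=
  sub_fm (epsilon (inhabits Bot) (fun F : fm (wty k :: gctx m) => code_fm F = c))
         (up (lift m k)).

Definition witnessed (k : nat) : fm (wty k :: gctx k) :=
  let (m, c) := Cantor.of_nat (snd (Cantor.of_nat k)) in candidate m c k.

Fixpoint hyps (k : nat) : list (fm (gctx k)) :=
  match k with
  | 0 => H0
  | S k' =>
      if excluded_middle_informative (prf Ax (Ex _ (witnessed k') :: hyps k') Bot)
      then map wk_fm (hyps k') else witnessed k' :: map wk_fm (hyps k')
  end.

Lemma lift_refl m : lift m m = id_sub.
Proof.
  destruct m; cbn [lift]; destruct Nat.eq_dec as [e|e]; try easy;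
    now rewrite (UIP_refl _ _ e).
Qed.

Lemma lift_S m k : m <= k -> lift m (S k) = (fun A x => wk (lift m k x)).
Proof. intros L. cbn [lift]. destruct Nat.eq_dec; [lia|reflexivity]. Qed.

Lemma prf_lem G (H : list (fm G)) F F' :
  prf Ax (F :: H) F' -> prf Ax (Neg F :: H) F' -> prf Ax H F'.
Proof. intros K K'. exact (p_orE (p_ax _ H _ (Ax_lem F)) K K'). Qed.

Lemma prf_wk G (H : list (fm G)) A (F : fm G) :
  prf Ax H F -> prf Ax (map (wk_fm (A := A)) H) (wk_fm F).
Proof. intros. now apply prf_sub. Qed.

Lemma hyps_consistent k : ~ prf Ax (hyps k) Bot.
Proof.
  induction k as [|k IH]; [exact H0_consistent|].
  cbn. destruct excluded_middle_informative as [E|E]; intros K.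
  - apply IH. change (prf Ax (hyps k) (inst_fm Bot (canon (wty k)))).
    apply p_allE. now apply p_allI.
  - apply E. eapply p_exE; [apply p_hyp, in_eq|].
    apply prf_weaken with (1 := K). apply incl_cons; [apply in_eq|].
    cbn. auto using incl_tl, incl_refl.
Qed.

Lemma hyps_S k : incl (map wk_fm (hyps k)) (hyps (S k)).
Proof.
  cbn. destruct excluded_middle_informative; auto using incl_tl, incl_refl.
Qed.

Lemma hyps_wk k F : prf Ax (hyps k) F -> prf Ax (hyps (S k)) (wk_fm F).
Proof. intros K. exact (prf_weaken (prf_wk _ K) (hyps_S k)). Qed.

Definition evt (Q : nat -> Prop) : Prop := exists n, forall k, n <= k -> Q k.

Lemma evt_and (Q Q' : nat -> Prop) : evt Q -> evt Q' -> evt (fun k => Q k /\ Q' k).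
Proof.
  intros [n K] [n' K']. exists (n + n'). intros. split; [apply K|apply K']; lia.
Qed.

Lemma evt_mono (Q Q' : nat -> Prop) : (forall k, Q k -> Q' k) -> evt Q -> evt Q'.
Proof. intros I [n K]. exists n. auto. Qed.

Definition holds (F : forall k, fm (gctx k)) : Prop :=
  evt (fun k => prf Ax (hyps k) (F k)).

Definition coh_fm (F : forall k, fm (gctx k)) : Prop :=
  evt (fun k => F (S k) = wk_fm (F k)).

Definition coh_tm A (e : forall k, tm (gctx k) A) : Prop :=
  evt (fun k => e (S k) = wk (e k)).

Definition coh_sub G (s : forall k, sub G (gctx k)) : Prop :=
  evt (fun k => forall A x, s (S k) A x = wk (s k A x)).

Lemma holds_mono (F F' : forall k, fm (gctx k)) :
  (forall k, prf Ax (hyps k) (F k) -> prf Ax (hyps k) (F' k)) ->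
  holds F -> holds F'.
Proof. apply evt_mono. Qed.

Lemma holds_mono2 (F1 F2 F' : forall k, fm (gctx k)) :
  (forall k, prf Ax (hyps k) (F1 k) -> prf Ax (hyps k) (F2 k) ->
             prf Ax (hyps k) (F' k)) ->
  holds F1 -> holds F2 -> holds F'.
Proof.
  intros I K1 K2. eapply evt_mono; [|apply (evt_and K1 K2)]. intros k []. now apply I.
Qed.

Lemma holds_consistent : ~ holds (fun k => Bot).
Proof. intros [n K]. eapply hyps_consistent, (K n), le_n. Qed.

Lemma holds_at (F : forall k, fm (gctx k)) n k :
  (forall k, n <= k -> F (S k) = wk_fm (F k)) -> n <= k ->
  prf Ax (hyps k) (F k) -> holds F.
Proof.
  intros C L K. exists k. intros k' L'. induction L' as [|k' L' IH]; [exact K|].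
  rewrite C by lia. now apply hyps_wk.
Qed.

Lemma coh_lift_tm m A (t : tm (gctx m) A) : coh_tm (fun k => sub_tm t (lift m k)).
Proof.
  exists m. intros k L. rewrite lift_S by auto. unfold wk. now rewrite ren_sub.
Qed.

Lemma up_wk_sub G D A B (s : sub G D) :
  up (B := B) (fun C x => wk (B := A) (s C x)) = comp (up s) (up shift1).
Proof.
  rewrite up_comp. f_equal. extensionality C. extensionality x. apply wk_sub.
Qed.

Lemma henkin A (F : forall k, fm (A :: gctx k)) :
  evt (fun k => F (S k) = sub_fm (F k) (up shift1)) ->
  holds (fun k => Neg (Ex A (F k))) \/
  exists e : forall k, tm (gctx k) A, coh_tm e /\ holds (fun k => inst_fm (F k) (e k)).
Proof.
  intros [n C].
  assert (EF : forall k, n <= k -> F k = sub_fm (F n) (up (lift n k))).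
  { intros k L. induction L as [|k L IH].
    - now rewrite lift_refl, up_id, sub_id_fm.
    - rewrite C, IH, lift_S by auto. rewrite sub_sub_fm. f_equal.
      symmetry. apply (up_wk_sub (wty k) A (lift n k)). }
  assert (K : exists k, n <= k /\ wty k = A /\
    snd (Cantor.of_nat k) = Cantor.to_nat (n, code_fm (F n))).
  { exists (Cantor.to_nat (code_ty A, Cantor.to_nat (n, code_fm (F n)))).
    split; [|split].
    - pose proof (Cantor.to_nat_non_decreasing (code_ty A)
        (Cantor.to_nat (n, code_fm (F n)))).
      pose proof (Cantor.to_nat_non_decreasing n (code_fm (F n))). lia.
    - apply code_ty_inj. unfold wty. rewrite Cantor.cancel_of_to. cbn.
      apply (epsilon_spec (inhabits Nat) (fun B => code_ty B = code_ty A)). eauto.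
    - now rewrite Cantor.cancel_of_to. }
  destruct K as (k & L & EA & Ek). subst A.
  assert (EW : witnessed k = F k).
  { unfold witnessed. rewrite Ek, Cantor.cancel_of_to. unfold candidate.
    rewrite (EF k L). f_equal. apply code_fm_inj.
    apply (epsilon_spec (inhabits Bot) (fun B => code_fm B = code_fm (F n))). eauto. }
  destruct (classic (prf Ax (Ex _ (F k) :: hyps k) Bot)) as [E|E].
  - left. apply holds_at with (n := n) (k := k); auto; [|now apply p_impI].
    intros j Lj. now rewrite C.
  - right. exists (fun j => lift (S k) j vz). split.
    + apply (coh_lift_tm (S k) (Var vz)).
    + apply holds_at with (n := S k) (k := S k); auto.
      * intros j Lj. rewrite C, lift_S by lia.
        unfold wk_fm. change (fun A x => Var (vs x)) with (@shift1 (gctx j) (wty j)).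
        rewrite inst_up_fm. unfold inst_fm. rewrite sub_sub_fm, comp_scons.
        now rewrite <- wk_sub.
      * rewrite C, lift_refl by lia. rewrite inst_up_fm.
        replace (scons _ _) with (@id_sub (gctx (S k))).
        -- rewrite sub_id_fm. apply p_hyp. cbn.
           rewrite EW. destruct excluded_middle_informative; [easy|apply in_eq].
        -- apply sub_eq_cons; reflexivity.
Qed.

Lemma holds_decide (F : forall k, fm (gctx k)) :
  coh_fm F -> holds F \/ holds (fun k => Neg (F k)).
Proof.
  intros C. destruct (@henkin Nat (fun k => wk_fm (F k))) as [K|(e & _ & K)].
  - revert C. apply evt_mono. intros k ->. symmetry. apply sub_wk_fm.
  - right. revert K. apply holds_mono. intros k K. apply p_impI.
    eapply p_impE.
    + eapply prf_weaken; [exact K|auto using incl_tl, incl_refl].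
    + apply p_exI with Zero. rewrite inst_wk_fm. apply p_hyp, in_eq.
  - left. revert K. apply holds_mono. intros k. now rewrite inst_wk_fm.
Qed.

Lemma coh_sub_fm G (F : fm G) (s : forall k, sub G (gctx k)) :
  coh_sub s -> coh_fm (fun k => sub_fm F (s k)).
Proof.
  apply evt_mono. intros k C. unfold wk_fm. rewrite sub_sub_fm. f_equal.
  extensionality A. extensionality x. rewrite C. apply wk_sub.
Qed.

Lemma coh_sub_tm G A (t : tm G A) (s : forall k, sub G (gctx k)) :
  coh_sub s -> coh_tm (fun k => sub_tm t (s k)).
Proof.
  apply evt_mono. intros k C. unfold wk. rewrite ren_sub. f_equal.
  extensionality B. extensionality x. apply C.
Qed.

Lemma coh_sub_cons G B (e : forall k, tm (gctx k) B) (s : forall k, sub G (gctx k)) :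
  coh_tm e -> coh_sub s -> coh_sub (fun k => scons (e k) (s k)).
Proof.
  intros Ce Cs. eapply evt_mono; [|apply (evt_and Ce Cs)].
  intros k [E E']. now apply var_case.
Qed.

Lemma coh_sub_vars G (s : forall k, sub G (gctx k)) :
  (forall A (x : var G A), coh_tm (fun k => s k A x)) -> coh_sub s.
Proof.
  induction G as [|B G IH]; intros C.
  - exists 0. intros k _ A x. destruct (var_nil x).
  - specialize (IH (fun k A x => s k A (vs x)) (fun A x => C A (vs x))).
    eapply evt_mono; [|apply (evt_and (C B vz) IH)].
    intros k [E E']. now apply var_case.
Qed.

(** ** The term model *)

Definition germ (A : ty) : Type := {e : forall k, tm (gctx k) A | coh_tm e}.
Definition germ_at A (e : germ A) : forall k, tm (gctx k) A := proj1_sig e.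

Definition germ_eq A (e e' : germ A) : Prop :=
  holds (fun k => Eq (germ_at e k) (germ_at e' k)).

Definition elem (A : ty) : Type :=
  {c : germ A -> Prop | exists e, c = germ_eq e}.

Definition cls A (e : germ A) : elem A :=
  exist _ (germ_eq e) (ex_intro _ e eq_refl).

Definition repr A (d : elem A) : germ A :=
  proj1_sig (constructive_indefinite_description _ (proj2_sig d)).

Lemma cls_repr A (d : elem A) : cls (repr d) = d.
Proof.
  unfold repr. destruct constructive_indefinite_description as [e E]. cbn.
  destruct d as [c p]. cbn in E. now apply subset_eq_compat.
Qed.

Lemma germ_eq_sym A (e e' : germ A) : germ_eq e e' -> germ_eq e' e.
Proof. apply holds_mono. intros k. apply prf_sym. Qed.

Lemma germ_eq_trans A (e e' e'' : germ A) :
  germ_eq e e' -> germ_eq e' e'' -> germ_eq e e''.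
Proof. apply holds_mono2. intros k. apply prf_trans. Qed.

Lemma cls_eq A (e e' : germ A) : cls e = cls e' <-> germ_eq e e'.
Proof.
  split; intros E.
  - apply (f_equal (@proj1_sig _ _)) in E. cbn in E. rewrite E.
    exists 0. intros. apply p_refl.
  - apply subset_eq_compat. extensionality f. apply propositional_extensionality.
    split; eauto using germ_eq_sym, germ_eq_trans.
Qed.

Definition germ_sub (G : ctx) : Type := {s : forall k, sub G (gctx k) | coh_sub s}.
Definition sub_at G (s : germ_sub G) : forall k, sub G (gctx k) := proj1_sig s.

Definition germ_tm G A (t : tm G A) (s : germ_sub G) : germ A :=
  exist _ _ (coh_sub_tm t (proj2_sig s)).

Definition germ_cons G B (e : germ B) (s : germ_sub G) : germ_sub (B :: G) :=
  exist _ _ (coh_sub_cons (proj2_sig e) (proj2_sig s)).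

Definition repr_env G (r : env elem G) : germ_sub G :=
  exist _ (fun k A x => germ_at (repr (r A x)) k)
    (coh_sub_vars _ (fun A x => proj2_sig (repr (r A x)))).

Definition germ_var G (s : germ_sub G) A (x : var G A) : germ A :=
  germ_tm (Var x) s.

Definition represents G (s : germ_sub G) (r : env elem G) : Prop :=
  forall A x, cls (germ_var s x) = r A x.

Lemma repr_env_spec G (r : env elem G) : represents (repr_env r) r.
Proof.
  intros A x. rewrite <- (cls_repr (r A x)). apply cls_eq.
  exists 0. intros. apply p_refl.
Qed.

Lemma represents_cons G B (e : germ B) (s : germ_sub G) r :
  represents s r -> represents (germ_cons e s) (econs (cls e) r).
Proof.
  intros R. unfold represents. apply var_case.
  - apply cls_eq. exists 0. intros. apply p_refl.
  - intros A x. cbn. rewrite <- R. apply cls_eq.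
    exists 0. intros. apply p_refl.
Qed.

Lemma evt_vars G (Q : nat -> forall A, var G A -> Prop) :
  (forall A x, evt (fun k => Q k A x)) -> evt (fun k => forall A x, Q k A x).
Proof.
  induction G as [|B G IH]; intros C.
  - exists 0. intros k _ A x. destruct (var_nil x).
  - specialize (IH (fun k A x => Q k A (vs x)) (fun A x => C A (vs x))).
    eapply evt_mono; [|apply (evt_and (C B vz) IH)].
    intros k [E E']. now apply var_case.
Qed.

Definition tev G A (t : tm G A) (r : env elem G) : elem A :=
  cls (germ_tm t (repr_env r)).

Lemma tev_represents G A (t : tm G A) s r :
  represents s r -> cls (germ_tm t s) = tev t r.
Proof.
  intros R. apply cls_eq.
  assert (E : evt (fun k => forall B (x : var G B), prf Ax (hyps k)
     (Eq (sub_at s k x) (sub_at (repr_env r) k x)))).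
  { apply evt_vars. intros B x.
    change (germ_eq (germ_var s x) (germ_var (repr_env r) x)).
    apply cls_eq. now rewrite R, repr_env_spec. }
  revert E. apply evt_mono. intros k E. now apply prf_sub_cong.
Qed.

Lemma tev_sub G D A (t : tm G A) (s : sub G D) r :
  tev (sub_tm t s) r = tev t (fun B x => tev (s B x) r).
Proof.
  pose (s' := fun k => comp s (sub_at (repr_env r) k)).
  assert (C : coh_sub s').
  { apply coh_sub_vars. intros B x. apply coh_sub_tm. exact (proj2_sig (repr_env r)). }
  rewrite <- tev_represents with (s := exist _ s' C).
  - apply cls_eq. exists 0. intros k _. cbn. rewrite sub_sub. apply p_refl.
  - intros B x. apply cls_eq. exists 0. intros. apply p_refl.
Qed.

Definition term_structure : structure := {|
  dom := elem;
  mapp A B f d := tev (App v1 v0) (econs d (econs f enil));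
  mlam G A B t r := tev (Lam t) r;
  mpair A B d d' := tev (Pair v1 v0) (econs d' (econs d enil));
  mfst A B d := tev (Fst v0) (econs d enil);
  msnd A B d := tev (Snd v0) (econs d enil);
  mzero := tev Zero enil;
  msucc d := tev (Succ v0) (econs d enil);
  mrec A a f d := tev (Rec v2 v1 v0) (econs d (econs f (econs a enil)))
|}.

Lemma tev_var G A (x : var G A) r : tev (Var x) r = r A x.
Proof. apply repr_env_spec. Qed.

Lemma tev_scons G D B (t : tm D B) (s : sub G D) r :
  (fun A x => tev (scons t s x) r) = econs (tev t r) (fun A x => tev (s A x) r).
Proof. apply sub_eq_cons with (D := elem); reflexivity. Qed.

Lemma tev_snil D (r : env elem D) : (fun A x => tev (@snil D A x) r) = enil.
Proof. apply sub_eq_nil. Qed.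

Lemma ev_tev G A (t : tm G A) (r : env elem G) : ev term_structure t r = tev t r.
Proof.
  revert r. induction t; intros r; cbn.
  - symmetry. apply tev_var.
  - rewrite IHt1, IHt2, <- (tev_snil r), <- !tev_scons, <- tev_sub. reflexivity.
  - reflexivity.
  - rewrite IHt1, IHt2, <- (tev_snil r), <- !tev_scons, <- tev_sub. reflexivity.
  - rewrite IHt, <- (tev_snil r), <- !tev_scons, <- tev_sub. reflexivity.
  - rewrite IHt, <- (tev_snil r), <- !tev_scons, <- tev_sub. reflexivity.
  - rewrite <- (tev_snil r), <- tev_sub. reflexivity.
  - rewrite IHt, <- (tev_snil r), <- !tev_scons, <- tev_sub. reflexivity.
  - rewrite IHt1, IHt2, IHt3, <- (tev_snil r), <- !tev_scons, <- tev_sub. reflexivity.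
Qed.

Lemma truth G (F : fm G) (s : germ_sub G) (r : env elem G) :
  represents s r ->
  (sat term_structure F r <-> holds (fun k => sub_fm F (sub_at s k))).
Proof.
  revert s r. induction F; intros s r R; cbn [sat sub_fm].
  - rewrite !ev_tev, <- !(tev_represents _ R). apply cls_eq.
  - split; [easy|apply holds_consistent].
  - rewrite (IHF1 s r R), (IHF2 s r R). split.
    + intros [K1 K2]. revert K1 K2. apply holds_mono2. intros. now apply p_andI.
    + intros K. split; revert K; apply holds_mono; intros k.
      * apply p_andE1.
      * apply p_andE2.
  - rewrite (IHF1 s r R), (IHF2 s r R). split.
    + intros [K|K]; revert K; apply holds_mono; intros k.
      * apply p_orI1.
      * apply p_orI2.
    + intros K.
      destruct (holds_decide (coh_sub_fm F1 (proj2_sig s))) as [K1|K1]; [now left|right].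
      revert K K1. apply holds_mono2. intros k K K1.
      eapply p_orE; [exact K| |apply p_hyp, in_eq].
      apply p_botE. eapply p_impE; [|apply p_hyp, in_eq].
      eapply prf_weaken; [exact K1|auto using incl_tl, incl_refl].
  - rewrite (IHF1 s r R), (IHF2 s r R). split.
    + intros I.
      destruct (holds_decide (coh_sub_fm F1 (proj2_sig s))) as [K1|K1].
      * apply I in K1. revert K1. apply holds_mono. intros k K. apply p_impI.
        eapply prf_weaken; [exact K|auto using incl_tl, incl_refl].
      * revert K1. apply holds_mono. intros k K. apply p_impI, p_botE.
        eapply p_impE; [|apply p_hyp, in_eq].
        eapply prf_weaken; [exact K|auto using incl_tl, incl_refl].
    + apply holds_mono2. intros k. apply p_impE.
  - split.
    + intros K.
      destruct (@henkin A (fun k => sub_fm (Neg F) (up (sub_at s k))))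
        as [N|(e & Ce & N)].
      * eapply evt_mono; [|exact (proj2_sig s)]. intros k C.
        rewrite sub_sub_fm, up_comp. f_equal. f_equal.
        extensionality B. extensionality x. unfold sub_at. rewrite C. apply wk_sub.
      * revert N. apply holds_mono. intros k N. cbn in N.
        apply p_allI. eapply prf_lem; [apply p_hyp, in_eq|].
        apply p_botE. eapply p_impE.
        { eapply prf_weaken; [apply (prf_wk A N)|auto using incl_tl, incl_refl]. }
        apply p_exI with v0. fold (@shift1 (gctx k) A).
        change (prf Ax (Neg (sub_fm F (up (sub_at s k))) :: map wk_fm (hyps k))
          (inst_fm (sub_fm (Neg (sub_fm F (up (sub_at s k)))) (up shift1)) v0)).
        rewrite inst_up_fm. replace (scons _ _) with (@id_sub (A :: gctx k)).
        { rewrite sub_id_fm. apply p_hyp, in_eq. }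
        apply sub_eq_cons; reflexivity.
      * exfalso. pose (e' := exist _ e Ce : germ A).
        specialize (K (cls e')). rewrite (IHF _ _ (represents_cons e' R)) in K.
        apply holds_consistent. revert N K. apply holds_mono2. intros k N K.
        rewrite inst_up_fm in N. eapply p_impE; [exact N|exact K].
    + intros K d. rewrite <- (cls_repr d).
      rewrite (IHF _ _ (represents_cons (repr d) R)).
      revert K. apply holds_mono. intros k K.
      eapply p_allE in K. rewrite inst_up_fm in K. exact K.
  - split.
    + intros [d K]. rewrite <- (cls_repr d) in K.
      rewrite (IHF _ _ (represents_cons (repr d) R)) in K.
      revert K. apply holds_mono. intros k K.
      apply p_exI with (germ_at (repr d) k). rewrite inst_up_fm. exact K.
    + intros K.
      destruct (@henkin A (fun k => sub_fm F (up (sub_at s k))))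
        as [N|(e & Ce & N)].
      * eapply evt_mono; [|exact (proj2_sig s)]. intros k C.
        rewrite sub_sub_fm, up_comp. f_equal. f_equal.
        extensionality B. extensionality x. unfold sub_at. rewrite C. apply wk_sub.
      * exfalso. apply holds_consistent. revert N K. apply holds_mono2.
        intros k. apply p_impE.
      * pose (e' := exist _ e Ce : germ A). exists (cls e').
        rewrite (IHF _ _ (represents_cons e' R)). revert N. apply holds_mono.
        intros k N. now rewrite inst_up_fm in N.
Qed.

Lemma tev_eq G A (t u : tm G A) r : prf Ax [] (Eq t u) -> tev t r = tev u r.
Proof.
  intros K. apply cls_eq. exists 0. intros k _.
  apply prf_closed. exact (prf_sub Ax_sub K (sub_at (repr_env r) k)).
Qed.

Lemma term_model : is_model Ax term_structure.
Proof.
  split.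
  - intros G A B t r d. rewrite ev_tev. cbn.
    transitivity (tev (App (wk (Lam t)) v0) (econs d r)).
    + change (App (wk (Lam t)) v0) with
        (sub_tm (App v1 v0) (scons v0 (scons (wk (B := A) (Lam t)) snil))).
      rewrite tev_sub, !tev_scons, tev_snil, tev_var, wk_sub, tev_sub.
      do 4 f_equal. extensionality C. extensionality x. symmetry. apply tev_var.
    + apply tev_eq. replace t with (inst_tm (ren_tm t (up_ren (fun _ => @vs _ _ A))) v0)
        at 2; [apply p_beta|].
      unfold inst_tm. rewrite sub_ren.
      transitivity (sub_tm t id_sub); [|apply sub_id]. f_equal. apply sub_eq_cons; reflexivity.
  - intros G F r K. apply (truth F (repr_env_spec r)). exists 0. intros k _.
    apply prf_closed. exact (prf_sub Ax_sub K (sub_at (repr_env r) k)).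
Qed.

Definition init_env : env elem G0 :=
  fun A x => cls (exist _ _ (coh_lift_tm 0 (Var x))).

Lemma term_model_hyps F : In F H0 -> sat term_structure F init_env.
Proof.
  intros I.
  assert (C : coh_sub (fun k => lift 0 k)).
  { exists 0. intros k L A x. cbv beta. now rewrite (lift_S L). }
  apply (truth F (s := exist _ _ C)).
  - intros A x. apply cls_eq. exists 0. intros. apply p_refl.
  - apply holds_at with (n := 0) (k := 0); [|lia|].
    + intros k L. cbv beta. cbn [sub_at proj1_sig]. rewrite (lift_S L).
      unfold wk_fm. rewrite sub_sub_fm. f_equal.
      extensionality A. extensionality x. apply wk_sub.
    + change (prf Ax H0 (sub_fm F (lift 0 0))).
      rewrite (lift_refl 0). unfold gctx. rewrite sub_id_fm. now apply p_hyp.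
Qed.

End Henkin.

Theorem completeness (Ax : forall G, fm G -> Prop) :
  (forall G D (F : fm G) (s : sub G D), Ax G F -> Ax D (sub_fm F s)) ->
  (forall G (F : fm G), Ax G (Or F (Neg F))) ->
  forall G (F : fm G),
  (forall M, is_model Ax M -> forall r, sat M F r) -> prf Ax [] F.
Proof.
  intros Ax_sub Ax_lem G F V.
  destruct (classic (prf Ax [Neg F] Bot)) as [K|K].
  - eapply prf_lem; [exact Ax_lem|apply p_hyp, in_eq|now apply p_botE].
  - exfalso.
    apply (term_model_hyps Ax_sub Ax_lem K (Neg F) (in_eq _ _)).
    apply V. now apply term_model.
Qed.

(** * Models of E-HA^omega *)

Notation v4 := (Var (vs (vs (vs (vs vz))))).

Definition partial_sum {G X} (u : tm G (pfun X)) (b : tm G Nat) : tm G Nat :=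
  Rec Zero (Lam (Lam (add v0 (chi (wk (wk u)) v1)))) b.

Section Models.

Local Unset Strict Implicit.

Variable Ax : forall G, fm G -> Prop.
Variable M : structure.
Hypothesis HM : is_model Ax M.

Notation "f $ x" := (mapp M f x) (at level 11, left associativity).
Notation "⟦ t ⟧ r" := (ev M t r) (at level 10, t at level 200, r at level 9).
Notation O := (mzero M).
Notation S := (msucc M).
Notation "a ;; r" := (econs a r) (at level 60, right associativity).

Lemma model_ext A B (f g : M (A ~> B)%ty) : (forall x, f $ x = g $ x) -> f = g.
Proof.
  intros E.
  pose proof (@model_sound Ax M HM [A ~> B; A ~> B]%ty
    (Imp (All A (Eq (App (wk v1) v0) (App (wk v0) v0))) (Eq v1 v0))
    (g ;; f ;; enil)) as K.
  apply K; [|exact E]. apply p_impI, p_ext, p_hyp, in_eq.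
Qed.

Lemma ev_ren G A (t : tm G A) D (p : ren G D) r :
  ⟦ren_tm t p⟧ r = ⟦t⟧ (fun B x => r B (p B x)).
Proof.
  revert D p r. induction t; intros; cbn; f_equal; auto.
  apply model_ext. intros x. rewrite !(model_beta HM), IHt. f_equal.
  now apply sub_eq_cons with (D := M).
Qed.

Lemma ev_sub G A (t : tm G A) D (s : sub G D) r :
  ⟦sub_tm t s⟧ r = ⟦t⟧ (fun B x => ⟦s B x⟧ r).
Proof.
  revert D s r. induction t; intros; cbn; f_equal; auto.
  apply model_ext. intros x. rewrite !(model_beta HM), IHt. f_equal.
  apply sub_eq_cons with (D := M); [reflexivity|].
  intros C y. cbn. unfold wk. now rewrite ev_ren.
Qed.

Lemma sat_sub G (F : fm G) D (s : sub G D) r :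
  sat M (sub_fm F s) r <-> sat M F (fun B x => ⟦s B x⟧ r).
Proof.
  assert (E : forall G D (s : sub G D) r A (d : M A),
    (fun B x => ⟦up s x⟧ (d ;; r)) = (d ;; (fun B x => ⟦s B x⟧ r))).
  { intros. apply sub_eq_cons with (D := M); [reflexivity|].
    intros C y. cbn. unfold wk. now rewrite ev_ren. }
  revert D s r. induction F; intros; cbn.
  - now rewrite !ev_sub.
  - reflexivity.
  - now rewrite IHF1, IHF2.
  - now rewrite IHF1, IHF2.
  - now rewrite IHF1, IHF2.
  - split; intros K d; specialize (K d); rewrite IHF, E in *; exact K.
  - split; intros [d K]; exists d; rewrite IHF, E in *; exact K.
Qed.

Lemma sat_scons G A (F : fm (A :: G)) D (t : tm D A) (s : sub G D) r :
  sat M (sub_fm F (scons t s)) r <-> sat M F (⟦t⟧ r ;; (fun B x => ⟦s B x⟧ r)).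
Proof.
  rewrite sat_sub. replace (fun B x => _) with (⟦t⟧ r ;; (fun B x => ⟦s B x⟧ r));
    [reflexivity|].
  now apply sub_eq_cons with (D := M).
Qed.

Definition definable A (Q : M A -> Prop) : Prop :=
  exists G (F : fm (A :: G)) r, forall d, Q d <-> sat M F (d ;; r).

Lemma model_ind (Q : M Nat -> Prop) :
  definable Q -> Q O -> (forall n, Q n -> Q (S n)) -> forall n, Q n.
Proof.
  intros (G & F & r & E) K0 KS n. apply E.
  pose proof (@model_sound Ax M HM _
    (Imp (inst_fm F Zero) (Imp (All Nat (Imp F (sub_fm F (scons (Succ v0) shift1))))
      (All Nat F))) r) as K.
  apply K.
  - apply p_impI, p_impI, p_ind; apply p_hyp; cbn; auto.
  - apply sat_scons, E, K0.
  - intros d Kd. apply sat_scons, E, KS, E, Kd.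
Qed.

Lemma succ_neq_0 n : S n <> O.
Proof.
  pose proof (@model_sound Ax M HM [Nat] (Neg (Eq (Succ v0) Zero)) (n ;; enil)) as K.
  apply K, p_succ0.
Qed.

Lemma succ_inj m n : S m = S n -> m = n.
Proof.
  pose proof (@model_sound Ax M HM [Nat; Nat]
    (Imp (Eq (Succ v1) (Succ v0)) (Eq v1 v0)) (n ;; m ;; enil)) as K.
  apply K. apply p_impI, p_succI, p_hyp, in_eq.
Qed.

Lemma rec_0 A (a : M A) f : mrec M a f O = a.
Proof.
  pose proof (@model_sound Ax M HM [_; _] (Eq (Rec v1 v0 Zero) v1) (f ;; a ;; enil)) as K.
  apply K, p_rec0.
Qed.

Lemma rec_S A (a : M A) f n : mrec M a f (S n) = f $ n $ mrec M a f n.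
Proof.
  pose proof (@model_sound Ax M HM [_; _; _]
    (Eq (Rec v2 v1 (Succ v0)) (App (App v1 v0) (Rec v2 v1 v0))) (n ;; f ;; a ;; enil)) as K.
  apply K, p_recS.
Qed.

Lemma fst_pair A B (a : M A) (b : M B) : mfst M (mpair M a b) = a.
Proof.
  pose proof (@model_sound Ax M HM [_; _] (Eq (Fst (Pair v1 v0)) v1) (b ;; a ;; enil)) as K.
  apply K, p_fst.
Qed.

Lemma snd_pair A B (a : M A) (b : M B) : msnd M (mpair M a b) = b.
Proof.
  pose proof (@model_sound Ax M HM [_; _] (Eq (Snd (Pair v1 v0)) v0) (b ;; a ;; enil)) as K.
  apply K, p_snd.
Qed.

Ltac evM :=
  repeat (progress (cbn [ev econs wk ren_tm];
    rewrite ?rec_0, ?rec_S, ?fst_pair, ?snd_pair, ?(model_beta HM))).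

Notation I := (S O).

Definition addM (m n : M Nat) := ⟦add v1 v0⟧ (n ;; m ;; enil).
Definition predM (n : M Nat) := ⟦pred v0⟧ (n ;; enil).
Definition monusM (m n : M Nat) := ⟦monus v1 v0⟧ (n ;; m ;; enil).
Definition maxM (m n : M Nat) := addM m (monusM n m).
Definition distM (m n : M Nat) := addM (monusM m n) (monusM n m).
Definition ifzM A (n : M Nat) (s t : M A) := ⟦ifz v2 v1 v0⟧ (t ;; s ;; n ;; enil).

Lemma env_scons G D B (t : tm D B) (s : sub G D) (r : env M D) :
  (fun A x => ⟦scons t s x⟧ r) = (⟦t⟧ r ;; (fun A x => ⟦s A x⟧ r)).
Proof. now apply sub_eq_cons with (D := M). Qed.

Lemma env_snil D (r : env M D) : (fun A x => ⟦@snil D A x⟧ r) = enil.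
Proof. apply sub_eq_nil. Qed.

Lemma ev_op1 A B (c : tm [A] B) G (t : tm G A) r :
  ⟦sub_tm c (scons t snil)⟧ r = ⟦c⟧ (⟦t⟧ r ;; enil).
Proof. now rewrite ev_sub, env_scons, env_snil. Qed.

Lemma ev_op2 A B C (c : tm [A; B] C) G (t : tm G A) (u : tm G B) r :
  ⟦sub_tm c (scons t (scons u snil))⟧ r = ⟦c⟧ (⟦t⟧ r ;; ⟦u⟧ r ;; enil).
Proof. now rewrite ev_sub, !env_scons, env_snil. Qed.

Lemma ev_op3 A B C D (c : tm [A; B; C] D) G (t : tm G A) (u : tm G B) (w : tm G C) r :
  ⟦sub_tm c (scons t (scons u (scons w snil)))⟧ r =
  ⟦c⟧ (⟦t⟧ r ;; ⟦u⟧ r ;; ⟦w⟧ r ;; enil).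
Proof. now rewrite ev_sub, !env_scons, env_snil. Qed.

Lemma ev_add G (s t : tm G Nat) r : ⟦add s t⟧ r = addM (⟦s⟧ r) (⟦t⟧ r).
Proof. exact (ev_op2 (add v1 v0) t s r). Qed.

Lemma ev_pred G (t : tm G Nat) r : ⟦pred t⟧ r = predM (⟦t⟧ r).
Proof. exact (ev_op1 (pred v0) t r). Qed.

Lemma ev_monus G (s t : tm G Nat) r : ⟦monus s t⟧ r = monusM (⟦s⟧ r) (⟦t⟧ r).
Proof. exact (ev_op2 (monus v1 v0) t s r). Qed.

Lemma ev_max G (s t : tm G Nat) r : ⟦max s t⟧ r = maxM (⟦s⟧ r) (⟦t⟧ r).
Proof. unfold max. now rewrite ev_add, ev_monus. Qed.

Lemma ev_dist G (s t : tm G Nat) r : ⟦dist s t⟧ r = distM (⟦s⟧ r) (⟦t⟧ r).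
Proof. unfold dist. now rewrite ev_add, !ev_monus. Qed.

Lemma ev_ifz G A (n : tm G Nat) (s t : tm G A) r :
  ⟦ifz n s t⟧ r = ifzM (⟦n⟧ r) (⟦s⟧ r) (⟦t⟧ r).
Proof. exact (ev_op3 (ifz v2 v1 v0) t s n r). Qed.

Lemma add_0_r m : addM m O = m.
Proof. unfold addM, add. evM. reflexivity. Qed.

Lemma add_S_r m n : addM m (S n) = S (addM m n).
Proof.
  transitivity (⟦add v1 (Succ v0)⟧ (n ;; m ;; enil)); [now rewrite ev_add|].
  unfold add. evM. reflexivity.
Qed.

Lemma pred_0 : predM O = O.
Proof. unfold predM, pred. evM. reflexivity. Qed.

Lemma pred_S n : predM (S n) = n.
Proof. unfold predM, pred. evM. reflexivity. Qed.

Lemma monus_0_r m : monusM m O = m.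
Proof. unfold monusM, monus. evM. reflexivity. Qed.

Lemma monus_S_r m n : monusM m (S n) = predM (monusM m n).
Proof.
  transitivity (⟦monus v1 (Succ v0)⟧ (n ;; m ;; enil)); [now rewrite ev_monus|].
  unfold monus. evM. now rewrite ev_pred.
Qed.

Lemma ifz_0 A (s t : M A) : ifzM O s t = s.
Proof. unfold ifzM, ifz. evM. reflexivity. Qed.

Lemma ifz_S A n (s t : M A) : ifzM (S n) s t = t.
Proof. unfold ifzM, ifz. evM. reflexivity. Qed.

Lemma ev_canon X G (r : env M G) : ⟦canon X⟧ r = ⟦canon X⟧ enil.
Proof.
  revert G r. induction X; intros; cbn.
  - reflexivity.
  - apply model_ext. intros x. rewrite !(model_beta HM).
    now rewrite IHX2, (IHX2 _ (x ;; enil)).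
  - now rewrite IHX1, IHX2.
Qed.

Ltac evs :=
  repeat (progress (cbn [sat ev econs Neg in_dom leq chi val bnd one wk ren_tm];
    rewrite ?ev_add, ?ev_pred, ?ev_monus, ?ev_max, ?ev_dist, ?ev_ifz)).

Ltac induct n :=
  revert n; match goal with |- forall n, @?Q n => apply (model_ind (Q := Q)) end.

Tactic Notation "define_by" uconstr(F) uconstr(r) :=
  refine (ex_intro _ _ (ex_intro _ F (ex_intro _ r _)));
  intros ?; evs; try setoid_rewrite ev_add; reflexivity.

Lemma add_0_l n : addM O n = n.
Proof.
  induct n.
  - define_by (Eq (add Zero v0) v0) enil.
  - apply add_0_r.
  - intros n IH. now rewrite add_S_r, IH.
Qed.

Lemma add_S_l m n : addM (S m) n = S (addM m n).
Proof.
  induct n.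
  - define_by (Eq (add (Succ v1) v0) (Succ (add v1 v0))) (m ;; enil).
  - now rewrite !add_0_r.
  - intros n IH. now rewrite !add_S_r, IH.
Qed.

Lemma add_assoc m n p : addM m (addM n p) = addM (addM m n) p.
Proof.
  induct p.
  - define_by (Eq (add v1 (add v2 v0)) (add (add v1 v2) v0)) (m ;; n ;; enil).
  - now rewrite !add_0_r.
  - intros p IH. now rewrite !add_S_r, IH.
Qed.

Lemma add_cancel_l m n k : addM k m = addM k n -> m = n.
Proof.
  induct k.
  - define_by (Imp (Eq (add v0 v1) (add v0 v2)) (Eq v1 v2)) (m ;; n ;; enil).
  - now rewrite !add_0_l.
  - intros k IH. rewrite !add_S_l. intros E. apply IH. now apply succ_inj.
Qed.

Lemma nat_case n : n = O \/ exists m, n = S m.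
Proof.
  induct n.
  - define_by (Or (Eq v0 Zero) (Ex Nat (Eq v1 (Succ v0)))) enil.
  - now left.
  - intros n _. right. now exists n.
Qed.

Lemma trichotomy m n :
  (exists d, n = addM m d) \/ (exists d, m = S (addM n d)).
Proof.
  induct n.
  - define_by (Or (Ex Nat (Eq v1 (add v2 v0))) (Ex Nat (Eq v2 (Succ (add v1 v0)))))
      (m ;; enil).
  - destruct (nat_case m) as [->|[k ->]].
    + left. exists O. now rewrite add_0_l.
    + right. exists k. now rewrite add_0_l.
  - intros n [[d ->]|[d ->]].
    + left. exists (S d). now rewrite add_S_r.
    + destruct (nat_case d) as [->|[e ->]].
      * left. exists O. now rewrite !add_0_r.
      * right. exists e. now rewrite add_S_l, add_S_r.
Qed.

Lemma monus_SS m n : monusM (S m) (S n) = monusM m n.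
Proof.
  induct n.
  - define_by (Eq (monus (Succ v1) (Succ v0)) (monus v1 v0)) (m ;; enil).
  - now rewrite monus_S_r, !monus_0_r, pred_S.
  - intros n IH. now rewrite monus_S_r, IH, monus_S_r.
Qed.

Lemma monus_0_l n : monusM O n = O.
Proof.
  induct n.
  - define_by (Eq (monus Zero v0) Zero) enil.
  - apply monus_0_r.
  - intros n IH. now rewrite monus_S_r, IH, pred_0.
Qed.

Lemma add_monus m d : monusM (addM m d) m = d.
Proof.
  induct m.
  - define_by (Eq (monus (add v0 v1) v0) v1) (d ;; enil).
  - now rewrite add_0_l, monus_0_r.
  - intros m IH. now rewrite add_S_l, monus_SS.
Qed.

Lemma monus_add m d : monusM m (addM m d) = O.
Proof.
  induct m.
  - define_by (Eq (monus v0 (add v0 v1)) Zero) (d ;; enil).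
  - apply monus_0_l.
  - intros m IH. now rewrite add_S_l, monus_SS.
Qed.

Definition leM (m n : M Nat) : Prop := monusM m n = O.

Lemma le_add m d : leM m (addM m d).
Proof. apply monus_add. Qed.

Lemma le_ex m n : leM m n <-> exists d, n = addM m d.
Proof.
  split; [|intros [d ->]; apply le_add].
  destruct (trichotomy m n) as [|[d ->]]; [easy|].
  rewrite <- add_S_r. unfold leM. rewrite add_monus.
  intros E. now apply succ_neq_0 in E.
Qed.

Lemma le_refl n : leM n n.
Proof. apply le_ex. exists O. now rewrite add_0_r. Qed.

Lemma le_trans m n p : leM m n -> leM n p -> leM m p.
Proof.
  rewrite !le_ex. intros [d ->] [e ->]. exists (addM d e). now rewrite add_assoc.
Qed.

Lemma le_succ n : leM n (S n).
Proof. apply le_ex. exists I. now rewrite add_S_r, add_0_r. Qed.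

Lemma not_le_succ n d : n <> S (addM n d).
Proof.
  rewrite <- add_S_r. rewrite <- (add_0_r n) at 1. intros E.
  apply add_cancel_l in E. symmetry in E. now apply succ_neq_0 in E.
Qed.

Lemma dist_refl n : distM n n = O.
Proof.
  unfold distM. rewrite <- (add_0_r n) at 2 3. now rewrite monus_add, add_0_l, add_monus.
Qed.

Lemma dist_neq m n : m <> n -> exists k, distM m n = S k.
Proof.
  intros N. unfold distM. destruct (trichotomy m n) as [[d ->]|[d ->]].
  - rewrite monus_add, add_0_l, add_monus.
    destruct (nat_case d) as [->|]; [now rewrite add_0_r in N|easy].
  - rewrite <- add_S_r, monus_add, add_0_r, add_monus. now exists d.
Qed.

Lemma max_l m d : maxM (addM m d) m = addM m d.
Proof. unfold maxM. now rewrite monus_add, add_0_r. Qed.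

Lemma max_r m d : maxM m (addM m d) = addM m d.
Proof. unfold maxM. now rewrite add_monus. Qed.

Lemma le_max_l m n : leM m (maxM m n).
Proof. apply le_add. Qed.

Lemma le_max_r m n : leM n (maxM m n).
Proof.
  destruct (trichotomy m n) as [[d ->]|[d ->]].
  - rewrite max_r. apply le_refl.
  - rewrite <- add_S_r, max_l. apply le_add.
Qed.

(** * Finite partial functions *)

Section PartialFunctions.

Variable X : ty.

Definition bndM (u : M (pfun X)) : M Nat := mfst M u.
Definition chiM (u : M (pfun X)) (n : M Nat) : M Nat := mfst M (msnd M u) $ n.
Definition valM (u : M (pfun X)) (n : M Nat) : M X := msnd M (msnd M u) $ n.
Definition canonM : M X := ⟦canon X⟧ enil.
Definition emptyM : M (pfun X) := ⟦empty X⟧ enil.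
Definition hatM (u : M (pfun X)) : M (Nat ~> X)%ty := ⟦hat v0⟧ (u ;; enil).
Definition oplusM (u : M (pfun X)) (n : M Nat) (x : M X) : M (pfun X) :=
  ⟦oplus v2 v1 v0⟧ (x ;; n ;; u ;; enil).
Definition sumM (u : M (pfun X)) (b : M Nat) : M Nat := ⟦partial_sum v1 v0⟧ (b ;; u ;; enil).
Definition cardM (u : M (pfun X)) : M Nat := sumM u (bndM u).

Lemma sub_canon Y G D (s : sub G D) : sub_tm (canon Y) s = canon Y.
Proof. revert G D s. induction Y; intros; cbn; f_equal; auto. Qed.

Lemma sub_empty G D (s : sub G D) : sub_tm (empty X) s = empty X.
Proof. unfold empty. cbn. now rewrite sub_canon. Qed.

Lemma ev_empty G (r : env M G) : ⟦empty X⟧ r = emptyM.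
Proof.
  unfold emptyM. rewrite <- (sub_empty (@snil G)), ev_sub. now rewrite env_snil.
Qed.

Lemma sub_ifz G D A (n : tm G Nat) (t u : tm G A) (s : sub G D) :
  sub_tm (ifz n t u) s = ifz (sub_tm n s) (sub_tm t s) (sub_tm u s).
Proof. unfold ifz. cbn [sub_tm]. now rewrite !sub_wk. Qed.

Lemma sub_hat G D (u : tm G (pfun X)) (s : sub G D) :
  sub_tm (hat u) s = hat (sub_tm u s).
Proof.
  unfold hat. cbn [sub_tm]. rewrite sub_ifz. unfold chi, val. cbn [sub_tm].
  now rewrite sub_canon, !sub_wk.
Qed.

Lemma sub_oplus G D (u : tm G (pfun X)) n x (s : sub G D) :
  sub_tm (oplus u n x) s = oplus (sub_tm u s) (sub_tm n s) (sub_tm x s).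
Proof.
  unfold oplus. rewrite sub_ifz. unfold chi, val, bnd, one, dist, max, add, monus, pred.
  cbn [sub_tm]. rewrite !sub_ifz. cbn [sub_tm]. rewrite !sub_wk.
  reflexivity.
Qed.

Lemma ev_hat G (u : tm G (pfun X)) r : ⟦hat u⟧ r = hatM (⟦u⟧ r).
Proof.
  unfold hatM. change u with (sub_tm v0 (scons u (@snil G))) at 1.
  now rewrite <- sub_hat, ev_op1.
Qed.

Lemma ev_oplus G (u : tm G (pfun X)) n x r :
  ⟦oplus u n x⟧ r = oplusM (⟦u⟧ r) (⟦n⟧ r) (⟦x⟧ r).
Proof. exact (ev_op3 (oplus v2 v1 v0) x n u r). Qed.

Lemma ev_sum G (u : tm G (pfun X)) b r : ⟦partial_sum u b⟧ r = sumM (⟦u⟧ r) (⟦b⟧ r).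
Proof. exact (ev_op2 (partial_sum v1 v0) b u r). Qed.

Lemma ev_card G (u : tm G (pfun X)) r : ⟦card u⟧ r = cardM (⟦u⟧ r).
Proof. exact (ev_sum u (bnd u) r). Qed.

Record is_pfM (u : M (pfun X)) : Prop := {
  pf_dec : forall n, chiM u n = O \/ chiM u n = I;
  pf_val : forall n, chiM u n = O -> valM u n = canonM;
  pf_bnd : forall n, leM (bndM u) n -> chiM u n = O;
  pf_max : forall n, bndM u = S n -> chiM u n = I
}.

Lemma sat_is_pf G (u : M (pfun X)) (r : env M G) :
  sat M (is_pf v0) (u ;; r) <-> is_pfM u.
Proof.
  assert (E : sat M (is_pf v0) (u ;; r) <->
    (forall n, chiM u n = O \/ chiM u n = I) /\
    (forall n, chiM u n = O -> valM u n = canonM) /\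
    (forall n, leM (bndM u) n -> chiM u n = O) /\
    (forall n, bndM u = S n -> chiM u n = I)).
  { unfold is_pf. evs. setoid_rewrite ev_canon. setoid_rewrite ev_monus. reflexivity. }
  rewrite E. split; [intros (?&?&?&?); now split|intros []; auto].
Qed.

Lemma oplus_old u n x : chiM u n = I -> oplusM u n x = u.
Proof.
  intros E. unfold oplusM, oplus. rewrite ev_ifz. evs.
  change (mfst M (msnd M u) $ n) with (chiM u n). rewrite E. apply ifz_S.
Qed.

Lemma oplus_fresh u n x : chiM u n = O ->
  oplusM u n x = mpair M (maxM (bndM u) (S n))
    (mpair M (mlam M (ifz (dist v0 v2) one (chi v3 v0)) (x ;; n ;; u ;; enil))
             (mlam M (ifz (dist v0 v2) v1 (val v3 v0)) (x ;; n ;; u ;; enil))).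
Proof.
  intros E. unfold oplusM, oplus. rewrite ev_ifz. evs.
  change (mfst M (msnd M u) $ n) with (chiM u n). rewrite E, ifz_0. reflexivity.
Qed.

Lemma oplus_bnd u n x : chiM u n = O -> bndM (oplusM u n x) = maxM (bndM u) (S n).
Proof. intros E. rewrite oplus_fresh by auto. apply fst_pair. Qed.

Lemma oplus_chi u n x j : chiM u n = O ->
  chiM (oplusM u n x) j = ifzM (distM j n) I (chiM u j).
Proof.
  intros E. rewrite oplus_fresh by auto. unfold chiM.
  rewrite snd_pair, fst_pair, (model_beta HM). now evs.
Qed.

Lemma oplus_val u n x j : chiM u n = O ->
  valM (oplusM u n x) j = ifzM (distM j n) x (valM u j).
Proof.
  intros E. rewrite oplus_fresh by auto. unfold valM.
  rewrite !snd_pair, (model_beta HM). now evs.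
Qed.

Lemma oplus_chi_new u n x : is_pfM u -> chiM (oplusM u n x) n = I.
Proof.
  intros K. destruct (pf_dec K n) as [E|E].
  - now rewrite oplus_chi, dist_refl, ifz_0.
  - now rewrite oplus_old.
Qed.

Lemma oplus_val_new u n x : chiM u n = O -> valM (oplusM u n x) n = x.
Proof. intros E. now rewrite oplus_val, dist_refl, ifz_0. Qed.

Lemma oplus_chi_other u n x j : chiM u n = O -> j <> n ->
  chiM (oplusM u n x) j = chiM u j.
Proof.
  intros E N. rewrite oplus_chi by auto. destruct (dist_neq N) as [k ->]. apply ifz_S.
Qed.

Lemma oplus_val_other u n x j : chiM u n = O -> j <> n ->
  valM (oplusM u n x) j = valM u j.
Proof.
  intros E N. rewrite oplus_val by auto. destruct (dist_neq N) as [k ->]. apply ifz_S.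
Qed.

Lemma oplus_mono u n x j : is_pfM u -> chiM u j = I ->
  chiM (oplusM u n x) j = I /\ valM (oplusM u n x) j = valM u j.
Proof.
  intros K E. destruct (pf_dec K n) as [E'|E'].
  - assert (N : j <> n).
    { intros ->. rewrite E in E'. now apply succ_neq_0 in E'. }
    now rewrite oplus_chi_other, oplus_val_other.
  - now rewrite oplus_old.
Qed.

Lemma empty_chi n : chiM emptyM n = O.
Proof. unfold emptyM, empty, chiM. evM. reflexivity. Qed.

Lemma is_pf_empty : is_pfM emptyM.
Proof.
  split.
  - intros n. left. apply empty_chi.
  - intros n _. unfold emptyM, empty, valM. evM. apply ev_canon.
  - intros n _. apply empty_chi.
  - intros n E. unfold emptyM, empty, bndM in E. cbn in E. rewrite fst_pair in E.
    symmetry in E. now apply succ_neq_0 in E.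
Qed.

Lemma is_pf_oplus u n x : is_pfM u -> is_pfM (oplusM u n x).
Proof.
  intros K. destruct (pf_dec K n) as [E|E]; [|now rewrite oplus_old].
  split.
  - intros j. destruct (classic (j = n)) as [->|N].
    + right. now apply oplus_chi_new.
    + rewrite oplus_chi_other by auto. apply (pf_dec K).
  - intros j. destruct (classic (j = n)) as [->|N].
    + rewrite oplus_chi_new by auto. intros E'. now apply succ_neq_0 in E'.
    + rewrite oplus_chi_other, oplus_val_other by auto. apply (pf_val K).
  - intros j. rewrite oplus_bnd by auto. intros L.
    destruct (classic (j = n)) as [->|N].
    + assert (L' : leM (S n) n) by (eapply le_trans; [apply le_max_r|exact L]).
      apply le_ex in L'. destruct L' as [d L']. rewrite add_S_l in L'.
      now apply not_le_succ in L'.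
    + rewrite oplus_chi_other by auto. apply (pf_bnd K).
      eapply le_trans; [apply le_max_l|exact L].
  - intros j. rewrite oplus_bnd by auto.
    destruct (classic (j = n)) as [->|N]; [intros _; now apply oplus_chi_new|].
    rewrite oplus_chi_other by auto.
    destruct (trichotomy (S n) (bndM u)) as [[d L]|[d L]].
    + intros L'. apply (pf_max K). now rewrite L, max_l, <- L in L'.
    + rewrite L, <- add_S_r, max_r, add_S_r, <- L. intros L'.
      apply succ_inj in L'. now destruct N.
Qed.

Lemma sum_0 u : sumM u O = O.
Proof. unfold sumM, partial_sum. evM. reflexivity. Qed.

Lemma sum_S u b : sumM u (S b) = addM (sumM u b) (chiM u b).
Proof.
  transitivity (⟦partial_sum v1 (Succ v0)⟧ (b ;; u ;; enil)); [now rewrite ev_sum|].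
  unfold partial_sum. evM. now evs.
Qed.

Lemma sum_tail u d : is_pfM u -> sumM u (addM (bndM u) d) = cardM u.
Proof.
  intros K. induct d.
  - exists _, (Eq (partial_sum v1 (add (bnd v1) v0)) (partial_sum v1 (bnd v1))), (u ;; enil).
    intros d. evs. now rewrite !ev_sum, ev_add.
  - now rewrite add_0_r.
  - intros d IH. rewrite add_S_r, sum_S, IH, (pf_bnd K); [apply add_0_r|apply le_add].
Qed.

Lemma sum_oplus_before u n x : chiM u n = O ->
  forall j, leM j n -> sumM (oplusM u n x) j = sumM u j.
Proof.
  intros E j. induct j.
  - exists _, (Imp (leq v0 v2) (Eq (partial_sum (oplus v3 v2 v1) v0) (partial_sum v3 v0))),
      (x ;; n ;; u ;; enil).
    intros j. evs. now rewrite !ev_sum, ev_oplus.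
  - intros _. now rewrite !sum_0.
  - intros j IH L. rewrite !sum_S, IH, oplus_chi_other; auto.
    + intros ->. apply le_ex in L. destruct L as [d L]. rewrite add_S_l in L.
      now apply not_le_succ in L.
    + eapply le_trans; [apply le_succ|exact L].
Qed.

Lemma sum_oplus_after u n x d : is_pfM u -> chiM u n = O ->
  sumM (oplusM u n x) (addM (S n) d) = S (sumM u (addM (S n) d)).
Proof.
  intros K E. induct d.
  - exists _, (Eq (partial_sum (oplus v3 v2 v1) (add (Succ v2) v0))
                  (Succ (partial_sum v3 (add (Succ v2) v0)))), (x ;; n ;; u ;; enil).
    intros d. evs. now rewrite !ev_sum, ev_oplus, ev_add.
  - rewrite add_0_r, !sum_S, E, oplus_chi_new by auto.
    now rewrite sum_oplus_before, add_S_r, add_0_r by auto using le_refl.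
  - intros d IH. rewrite add_S_r, !sum_S, IH, oplus_chi_other; auto.
    + now rewrite add_S_l.
    + rewrite add_S_l. intros L. symmetry in L. now apply not_le_succ in L.
Qed.

Lemma card_empty : cardM emptyM = O.
Proof.
  unfold cardM. replace (bndM emptyM) with O; [apply sum_0|].
  unfold emptyM, empty, bndM. cbn. now rewrite fst_pair.
Qed.

Lemma card_oplus u n x : is_pfM u -> chiM u n = O ->
  cardM (oplusM u n x) = S (cardM u).
Proof.
  intros K E. unfold cardM at 1. rewrite oplus_bnd by auto.
  pose proof (le_max_l (bndM u) (S n)) as L. apply le_ex in L. destruct L as [d L].
  pose proof (le_max_r (bndM u) (S n)) as L'. apply le_ex in L'. destruct L' as [d' L'].
  rewrite L', sum_oplus_after, <- L', L, sum_tail by auto. reflexivity.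
Qed.

(** * Threads *)

Variable phi : M ((Nat ~> X) ~> Nat)%ty.

Definition nextM (u : M (pfun X)) : M Nat := phi $ hatM u.
Definition threadM (a : M (Nat ~> X)%ty) (i : M Nat) : M (pfun X) :=
  ⟦thread v2 v1 v0⟧ (i ;; a ;; phi ;; enil).
Definition thread_pfM (u : M (pfun X)) (i : M Nat) : M (pfun X) :=
  ⟦thread_pf v2 v1 v0⟧ (i ;; u ;; phi ;; enil).

Lemma ev_thread G p (a : tm G (Nat ~> X)) i r :
  ⟦p⟧ r = phi -> ⟦thread p a i⟧ r = threadM (⟦a⟧ r) (⟦i⟧ r).
Proof.
  intros E. unfold threadM. rewrite <- E, <- (ev_op3 (thread v2 v1 v0) i a p r). f_equal.
  unfold thread, hat_app. cbn [sub_tm scons]. rewrite sub_empty, sub_oplus.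
  cbn [sub_tm]. now rewrite sub_hat.
Qed.

Lemma ev_thread_pf G p (u : tm G (pfun X)) i r :
  ⟦p⟧ r = phi -> ⟦thread_pf p u i⟧ r = thread_pfM (⟦u⟧ r) (⟦i⟧ r).
Proof.
  intros E. unfold thread_pfM. rewrite <- E, <- (ev_op3 (thread_pf v2 v1 v0) i u p r). f_equal.
  unfold thread_pf, hat_app. cbn [sub_tm scons]. rewrite sub_empty, sub_ifz, sub_oplus.
  unfold chi, val. cbn [sub_tm]. now rewrite sub_hat.
Qed.

Lemma thread_0 a : threadM a O = emptyM.
Proof. unfold threadM, thread. cbn [ev econs]. rewrite rec_0. apply ev_empty. Qed.

Lemma thread_S a i :
  threadM a (S i) =
  oplusM (threadM a i) (nextM (threadM a i)) (a $ nextM (threadM a i)).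
Proof.
  transitivity (⟦thread v2 v1 (Succ v0)⟧ (i ;; a ;; phi ;; enil));
    [now rewrite ev_thread|].
  unfold thread. cbn [ev econs]. rewrite rec_S, (model_beta HM). cbn [ev]. rewrite (model_beta HM).
  change (mrec M _ _ _) with (threadM a i).
  rewrite ev_oplus. cbn [ev econs wk ren_tm hat_app]. now rewrite ev_hat.
Qed.

Lemma thread_pf_0 u : thread_pfM u O = emptyM.
Proof. unfold thread_pfM, thread_pf. cbn [ev econs]. rewrite rec_0. apply ev_empty. Qed.

Lemma thread_pf_S u i :
  let w := thread_pfM u i in
  thread_pfM u (S i) =
  ifzM (chiM u (nextM w)) w (oplusM w (nextM w) (valM u (nextM w))).
Proof.
  transitivity (⟦thread_pf v2 v1 (Succ v0)⟧ (i ;; u ;; phi ;; enil));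
    [now rewrite ev_thread_pf|].
  unfold thread_pf. cbn [ev econs]. rewrite rec_S, (model_beta HM). cbn [ev]. rewrite (model_beta HM).
  change (mrec M _ _ _) with (thread_pfM u i).
  rewrite ev_ifz, ev_oplus. cbn [ev econs wk ren_tm hat_app chi val].
  now rewrite ev_hat.
Qed.

Lemma is_pf_thread a i : is_pfM (threadM a i).
Proof.
  induct i.
  - exists _, (sub_fm (is_pf v0) (scons (thread v2 v1 v0) snil)), (a ;; phi ;; enil).
    intros i. rewrite sat_scons, env_snil, sat_is_pf, ev_thread; reflexivity.
  - rewrite thread_0. apply is_pf_empty.
  - intros i IH. rewrite thread_S. now apply is_pf_oplus.
Qed.

Lemma thread_mono a i d j :
  chiM (threadM a i) j = I -> chiM (threadM a (addM i d)) j = I.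
Proof.
  intros E. induct d.
  - exists _, (in_dom v1 (thread v4 v3 (add v2 v0))), (j ;; i ;; a ;; phi ;; enil).
    intros d. evs. rewrite ev_thread by reflexivity. now evs.
  - now rewrite add_0_r.
  - intros d IH. rewrite add_S_r, thread_S. apply oplus_mono; auto using is_pf_thread.
Qed.

Lemma thread_mono_le a i i' j :
  leM i i' -> chiM (threadM a i) j = I -> chiM (threadM a i') j = I.
Proof. intros L. apply le_ex in L. destruct L as [d ->]. apply thread_mono. Qed.

Lemma thread_next a i : chiM (threadM a (S i)) (nextM (threadM a i)) = I.
Proof. rewrite thread_S. apply oplus_chi_new, is_pf_thread. Qed.

Lemma thread_val a i j : chiM (threadM a i) j = I -> valM (threadM a i) j = a $ j.
Proof.
  induct i.
  - exists _, (Imp (in_dom v1 (thread v3 v2 v0))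
      (Eq (val (thread v3 v2 v0) v1) (App v2 v1))), (j ;; a ;; phi ;; enil).
    intros i. evs. rewrite ev_thread by reflexivity. reflexivity.
  - rewrite thread_0, empty_chi. intros E. symmetry in E. now apply succ_neq_0 in E.
  - intros i IH. rewrite thread_S. set (u := threadM a i) in *. set (n := nextM u).
    destruct (pf_dec (is_pf_thread a i) n) as [E|E]; fold u in E.
    + destruct (classic (j = n)) as [->|N].
      * intros _. now apply oplus_val_new.
      * rewrite oplus_chi_other, oplus_val_other; auto.
    + rewrite oplus_old; auto.
Qed.

Definition agree (u : M (pfun X)) (a b : M (Nat ~> X)%ty) : Prop :=
  forall m, chiM u m = I -> b $ m = a $ m.

Lemma thread_ext a b i : agree (threadM a i) a b ->
  forall j, leM j i -> threadM b j = threadM a j.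
Proof.
  intros K j. induct j.
  - exists _, (Imp (leq v0 v1) (Eq (thread v4 v3 v0) (thread v4 v2 v0))),
      (i ;; a ;; b ;; phi ;; enil).
    intros j. evs. now rewrite !ev_thread by reflexivity.
  - intros _. now rewrite !thread_0.
  - intros j IH L. rewrite !thread_S, IH by (eapply le_trans; [apply le_succ|exact L]).
    f_equal. apply K. apply thread_mono_le with (1 := L). apply thread_next.
Qed.

Lemma thread_pf_thread a i j :
  leM j i -> thread_pfM (threadM a i) j = threadM a j.
Proof.
  induct j.
  - exists _, (Imp (leq v0 v1) (Eq (thread_pf v3 (thread v3 v2 v1) v0) (thread v3 v2 v0))),
      (i ;; a ;; phi ;; enil).
    intros j. evs. rewrite ev_thread_pf, !ev_thread by reflexivity. reflexivity.
  - intros _. now rewrite thread_pf_0, thread_0.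
  - intros j IH L.
    assert (L' : leM j i) by (eapply le_trans; [apply le_succ|exact L]).
    rewrite thread_pf_S, IH, thread_S by auto.
    assert (D : chiM (threadM a i) (nextM (threadM a j)) = I).
    { apply thread_mono_le with (1 := L). apply thread_next. }
    now rewrite D, ifz_S, thread_val.
Qed.

Definition updM (a : M (Nat ~> X)%ty) (n : M Nat) (x : M X) : M (Nat ~> X)%ty :=
  mlam M (ifz (dist v0 v2) v1 (App v3 v0)) (x ;; n ;; a ;; enil).

Lemma upd_app a n x j : updM a n x $ j = ifzM (distM j n) x (a $ j).
Proof. unfold updM. rewrite (model_beta HM). now evs. Qed.

Section BarInduction.

Hypothesis Ax_dc : forall G Y (F : fm (Y :: Y :: Nat :: G)), Ax (dc_fm F).

Lemma model_dc Y (R : M Nat -> M Y -> M Y -> Prop) :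
  (exists G (F : fm (Y :: Y :: Nat :: G)) r,
     forall n x y, R n x y <-> sat M F (y ;; x ;; n ;; r)) ->
  (forall n x, exists y, R n x y) ->
  exists f, forall n, R n (f $ n) (f $ S n).
Proof.
  intros (G & F & r & E) T.
  assert (K : sat M (dc_fm F) r) by (apply (model_sound HM), p_ax, Ax_dc).
  destruct K as [f K].
  - intros n x. destruct (T n x) as [y Hy]. exists y. now apply E.
  - exists f. intros n. apply E. specialize (K n).
    rewrite sat_scons in K.
    rewrite !env_scons in K. exact K.
Qed.

Lemma model_choice Y (R : M Nat -> M Y -> Prop) :
  (exists G (F : fm (Y :: Nat :: G)) r, forall n y, R n y <-> sat M F (y ;; n ;; r)) ->
  (forall n, exists y, R n y) -> exists f, forall n, R n (f $ n).
Proof.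
  intros (G & F & r & E) T.
  destruct (@model_dc Y (fun n _ y => R n y)) as [f K].
  - exists G, (sub_fm F (scons v0 (scons v2 shift3))), r. intros n x y.
    rewrite sat_scons, env_scons. apply E.
  - auto.
  - exists (mlam M (App v1 (Succ v0)) (f ;; enil)). intros n.
    rewrite (model_beta HM). apply K.
Qed.

Variables (G : ctx) (P : fm (pfun X :: G)) (r : env M G).

Definition satP (u : M (pfun X)) : Prop := sat M P (u ;; r).

Hypothesis bar : forall a, exists n, satP (threadM a n).
Hypothesis step : forall u, is_pfM u -> u = thread_pfM u (cardM u) ->
  (chiM u (nextM u) <> I -> forall x, satP (oplusM u (nextM u) x)) -> satP u.

Definition bad (i : M Nat) (a : M (Nat ~> X)%ty) : Prop :=
  cardM (threadM a i) = i /\ ~ satP (threadM a i).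

Lemma bad_step i a : bad i a -> exists b, bad (S i) b /\ agree (threadM a i) a b.
Proof.
  intros [C N]. set (u := threadM a i) in *. set (n := nextM u).
  assert (K : is_pfM u) by apply is_pf_thread.
  assert (E : chiM u n <> I /\ exists x, ~ satP (oplusM u n x)).
  { apply NNPP. intros E. apply N, step; auto.
    - rewrite C. symmetry. apply thread_pf_thread, le_refl.
    - intros D x. apply NNPP. eauto. }
  destruct E as [D [x B]].
  destruct (pf_dec K n) as [E|E]; [clear D|easy].
  assert (A : agree u a (updM a n x)).
  { intros m D. rewrite upd_app.
    assert (F : m <> n).
    { intros ->. rewrite E in D. symmetry in D. now apply succ_neq_0 in D. }
    destruct (dist_neq F) as [k ->]. apply ifz_S. }
  exists (updM a n x). split; [|exact A].
  assert (F : threadM (updM a n x) (S i) = oplusM u n x).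
  { rewrite thread_S, (thread_ext A (le_refl i)). fold u. fold n.
    now rewrite upd_app, dist_refl, ifz_0. }
  unfold bad. rewrite F. split; [|exact B]. rewrite card_oplus; congruence.
Qed.

Definition shift4 {D A B C E} : sub D (A :: B :: C :: E :: D) :=
  fun _ x => Var (vs (vs (vs (vs x)))).

Lemma bad_chain : ~ satP emptyM -> exists f : M (Nat ~> Nat ~> X)%ty,
  forall i, bad i (f $ i) /\ agree (threadM (f $ i) i) (f $ i) (f $ S i).
Proof.
  intros N.
  destruct (@model_dc (Nat ~> X)%ty (fun i a b =>
    bad i a -> bad (S i) b /\ agree (threadM a i) a b)) as [f K].
  - pose (B := fun (i : tm ((Nat ~> X) :: (Nat ~> X) :: Nat :: ((Nat ~> X) ~> Nat) :: G)%ty Nat)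
        a => And (Eq (card (thread v3 a i)) i)
                 (Neg (sub_fm P (scons (thread v3 a i) shift4)))).
    pose (C := All Nat (Imp (in_dom v0 (thread v4 v2 v3)) (Eq (App v1 v0) (App v2 v0)))
      : fm ((Nat ~> X) :: (Nat ~> X) :: Nat :: ((Nat ~> X) ~> Nat) :: G)%ty).
    exists _, (Imp (B v2 v1) (And (B (Succ v2) v0) C)), (phi ;; r).
    intros i a b. set (e := b ;; a ;; i ;; phi ;; r).
    assert (EB : forall j c, sat M (B j c) e <-> bad (⟦j⟧ e) (⟦c⟧ e)).
    { intros j c. unfold B, bad, satP. evs.
      now rewrite sat_scons, ev_card, ev_thread by reflexivity. }
    assert (EC : sat M C e <-> agree (threadM a i) a b).
    { unfold C, agree. cbn [sat in_dom chi ev econs].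
      split; intros A m; specialize (A m); rewrite ev_thread in * by reflexivity;
        exact A. }
    cbn [sat]. now rewrite !EB, EC.
  - intros i a. destruct (classic (bad i a)) as [B|B].
    + destruct (bad_step B) as [b K]. now exists b.
    + now exists a.
  - assert (B : forall i, bad i (f $ i)).
    { intros i. induct i.
      - exists _, (And (Eq (card (thread v2 (App v1 v0) v0)) v0)
          (Neg (sub_fm P (scons (thread v2 (App v1 v0) v0) shift3)))), (f ;; phi ;; r).
        intros i. unfold bad, satP. evs.
        now rewrite sat_scons, ev_card, ev_thread by reflexivity.
      - unfold bad. rewrite thread_0. split; [apply card_empty|exact N].
      - intros i IH. now apply K. }
    exists f. intros i. split; [apply B|now apply K].
Qed.

Theorem model_sbi : satP emptyM.
Proof.
  apply NNPP. intros N. destruct (bad_chain N) as [f K].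
  assert (A : forall i d, agree (threadM (f $ i) i) (f $ i) (f $ addM i d)).
  { intros i d. induct d.
    - exists _, (All Nat (Imp (in_dom v0 (thread v4 (App v3 v2) v2))
        (Eq (App (App v3 (add v2 v1)) v0) (App (App v3 v2) v0)))), (i ;; f ;; phi ;; enil).
      intros d. unfold agree. cbn [sat in_dom chi ev econs].
      split; intros A m; specialize (A m);
        rewrite ev_thread, ev_add in * by reflexivity; exact A.
    - rewrite add_0_r. now intros m.
    - intros d IH m D. rewrite add_S_r, <- (IH m D).
      apply K. apply thread_mono. now rewrite (thread_ext IH (le_refl i)). }
  destruct (@model_choice X (fun m x => forall i,
    chiM (threadM (f $ i) i) m = I -> x = f $ i $ m)) as [a L].
  - exists _, (All Nat (Imp (in_dom v2 (thread v4 (App v3 v0) v0))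
      (Eq v1 (App (App v3 v0) v2)))), (f ;; phi ;; enil).
    intros m x. cbn [sat in_dom chi ev econs].
    split; intros B i; specialize (B i); rewrite ev_thread in * by reflexivity; exact B.
  - intros m. destruct (classic (exists i, chiM (threadM (f $ i) i) m = I)) as [[i D]|D].
    + exists (f $ i $ m). intros i' D'.
      destruct (trichotomy i i') as [[d ->]|[d ->]].
      * symmetry. now apply A.
      * rewrite <- add_S_r. now apply A.
    + exists canonM. intros i D'. destruct D. now exists i.
  - destruct (bar a) as [n Pn]. destruct (K n) as [[_ B] _]. apply B.
    rewrite <- (thread_ext (b := a) (i := n)); [exact Pn| |apply le_refl].
    intros m D. now apply L.
Qed.

End BarInduction.

End PartialFunctions.

End Models.

Lemma sub_dc_fm G D X (F : fm (X :: X :: Nat :: G)) (s : sub G D) :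
  sub_fm (dc_fm F) s = dc_fm (sub_fm F (up (up (up s)))).
Proof.
  unfold dc_fm. cbn. do 3 f_equal. rewrite !sub_sub_fm. f_equal.
  rewrite !comp_scons, !comp_up_scons. cbn. do 3 f_equal.
  extensionality A. extensionality x. unfold comp. cbn.
  change (wk (B := Nat) (wk (B := Nat ~> X) (s A x)) = sub_tm (s A x) shift2).
  now rewrite !wk_sub, sub_sub.
Qed.

Lemma ax_sub G D (F : fm G) (s : sub G D) :
  LEM F \/ DC F -> LEM (sub_fm F s) \/ DC (sub_fm F s).
Proof.
  intros K. revert D s. destruct K as [[]|[]]; intros D s.
  - left. apply lem_intro.
  - right. rewrite sub_dc_fm. apply dc_intro.
Qed.

Unset Implicit Arguments.

Theorem theorem2p7 (G : ctx) (X : ty) (P : fm (pfun X :: G)) :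
  EPAw_DC [] (sBI P).
Proof.
  apply completeness.
  - apply ax_sub.
  - intros. left. apply lem_intro.
  - intros M HM r. unfold sBI, All_pf. cbn [sat]. intros phi [bar step].
    apply (sat_scons HM). rewrite (ev_empty HM).
    change (satP P r (emptyM M X)).
    apply (model_sbi HM) with (phi := phi).
    + intros. right. apply dc_intro.
    + intros a. destruct (bar a) as [n K]. exists n.
      apply (sat_scons HM) in K. rewrite (ev_thread HM (phi := phi)) in K by reflexivity.
      exact K.
    + intros u K E I. refine (proj1 (sat_scons HM P v0 shift2 _) (step u _ _ _)).
      * now apply (sat_is_pf HM).
      * cbn [sat S_phi ev]. rewrite (ev_thread_pf HM (phi := phi)) by reflexivity.
        now rewrite (ev_card HM).
      * intros N x. apply (sat_scons HM). rewrite (ev_oplus HM).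
        cbn [ev econs]. rewrite (ev_hat HM). apply I. intros Ein. apply N.
        cbn [sat in_dom chi ev econs one]. rewrite (ev_hat HM). exact Ein.
Qed.
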